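(* Let $\alpha\in(1,2]$, $\beta>0$ with $\beta\neq d$, $\sigma>0$, $C_\beta>0$, $b\in[-1,1]$, and let $Z_\alpha(\mu)=\int_{\mathbb{R}^d\times\mathbb{R}^+}\mu(B(x,r))\,M_\alpha(dr,dx)$, $\mu\in\mathcal{M}_{\alpha,\beta}$, where $M_\alpha$ is an $\alpha$-stable random measure with control measure $\sigma^\alpha C_\beta r^{-1-\beta}\,dr\,dx$ and constant skewness function $b$. Then: i) $Z_\alpha$ is stationary on $\mathcal{M}_{\alpha,\beta}$: for every $s\in\mathbb{R}^d$, the fields $(Z_\alpha(\tau_s\mu))_{\mu\in\mathcal{M}_{\alpha,\beta}}$ and $(Z_\alpha(\mu))_{\mu\in\mathcal{M}_{\alpha,\beta}}$ have the same finite-dimensional distributions. ii) $Z_\alpha$ is isotropic on $\mathcal{M}_{\alpha,\beta}$: for every $\Theta\in\mathcal{O}(\mathbb{R}^d)$, the fields $(Z_\alpha(\Theta\mu))_{\mu\in\mathcal{M}_{\alpha,\beta}}$ and $(Z_\alpha(\mu))_{\mu\in\mathcal{M}_{\alpha,\beta}}$ have the same finite-dimensional distributions. iii) $Z_\alpha$ is self-similar on $\mathcal{M}_{\alpha,\beta}$ with index $(d-\beta)/\alpha$: for every $a>0$, the fields $(Z_\alpha(\mu_a))_{\mu\in\mathcal{M}_{\alpha,\beta}}$ and $(a^{(d-\beta)/\alpha}Z_\alpha(\mu))_{\mu\in\mathcal{M}_{\alpha,\beta}}$ have the same finite-dimensional distributions.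
   Context: $d\ge1$ is an integer, $B(x,r)=\{y\in\mathbb{R}^d:\|y-x\|<r\}$ with $\|\cdot\|$ Euclidean, $\mathbb{R}^+=(0,\infty)$, $\mathcal{O}(\mathbb{R}^d)$ is the orthogonal group. $\varepsilon(a)=1,-1,0$ according to $a>0$, $a<0$, $a=0$. $\mathcal{M}$ is the space of signed measures on $\mathbb{R}^d$ with finite total variation; $\mathcal{M}_{\alpha,\beta}$ is the set of $\mu\in\mathcal{M}$ for which there exist a finite constant $C$ and $0<p<\beta<q$ with $\int_{\mathbb{R}^d}|\mu(B(x,r))|^\alpha dx\le C\min(r^p,r^q)$ for all $r>0$. For Borel $A$: $\tau_s\mu(A)=\mu(A-s)$, $\Theta\mu(A)=\mu(\Theta^{-1}A)$, $\mu_a(A)=\mu(a^{-1}A)$; these operations map $\mathcal{M}_{\alpha,\beta}$ into itself. For an $\alpha$-stable random measure $M_\alpha$ with control measure $m$ and constant skewness $b$ and $f\in L^\alpha(m)$, the stable integral $\int f\,dM_\alpha$ is well defined, linear in $f$, with characteristic function $\theta\mapsto\exp\big(-\int|\theta f|^\alpha(1-ib\,\varepsilon(\theta f)\tan(\pi\alpha/2))\,dm\big)$; $Z_\alpha(\mu)$ is well defined for $\mu\in\mathcal{M}_{\alpha,\beta}$. *)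

(* Defs.v *)
From HB Require Import structures.
From mathcomp Require Import all_boot all_order all_algebra.
From mathcomp Require Import all_classical all_reals all_analysis.
From mathcomp Require Import measurable_realfun complex.

Set Implicit Arguments.
Unset Strict Implicit.
Unset Printing Implicit Defensive.

Import Order.TTheory GRing.Theory Num.Theory.
Import numFieldNormedType.Exports.
Import HBSimple.

Local Open Scope classical_set_scope.
Local Open Scope ring_scope.

Definition cV_display : measure_display. Proof. exact: default_measure_display. Qed.

(* The product sigma-algebra, generated by the coordinates (as the library does
   for [n.-tuple T]); it is the Borel sigma-algebra of R^d. *)
Section measurable_cV.
Variables (R : realType) (d : nat).

Let coor (i : 'I_d) (x : 'cV[R]_d) : R := x i ord0.

Let cV_set0 : g_sigma_preimage coor set0.
Proof. exact: sigma_algebra0. Qed.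

Let cV_setC A : g_sigma_preimage coor A -> g_sigma_preimage coor (~` A).
Proof. exact: sigma_algebraC. Qed.

Let cV_bigcup (F : (set 'cV[R]_d)^nat) :
  (forall i, g_sigma_preimage coor (F i)) ->
  g_sigma_preimage coor (\bigcup_i (F i)).
Proof. exact: sigma_algebra_bigcup. Qed.

HB.instance Definition _ := @isMeasurable.Build cV_display
  'cV[R]_d (g_sigma_preimage coor) cV_set0 cV_setC cV_bigcup.

Lemma measurable_coor (i : 'I_d) :
  measurable_fun [set: 'cV[R]_d] (fun x : 'cV[R]_d => x i ord0).
Proof.
move=> _ Y mY; rewrite setTI; apply: sub_sigma_algebra => /=.
rewrite -bigcup_seq/=; exists i => /=; first by rewrite mem_index_enum.
by exists Y => //; rewrite setTI.
Qed.

Lemma measurable_fun_cV d' (T : measurableType d') (f : T -> 'cV[R]_d) :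
  (forall i, measurable_fun [set: T] (fun t => f t i ord0)) ->
  measurable_fun [set: T] f.
Proof.
move=> mf _ A mA; rewrite setTI.
suff : g_sigma_preimage coor `<=` [set B | measurable (f @^-1` B)] by exact.
apply: smallest_sub.
  split => /=.
  - by rewrite preimage_set0.
  - by move=> B mB; rewrite setTD preimage_setC; exact: measurableC.
  - by move=> F mF; rewrite preimage_bigcup; exact: bigcup_measurable.
rewrite -bigcup_seq; apply: bigcup_sub => i _ B [C mC <-] /=.
rewrite setTI -[X in measurable X]setTI; exact: (mf i measurableT C mC).
Qed.

End measurable_cV.

(* The norm that the library puts on matrices is the sup norm. *)
Definition enorm (R : realType) (d : nat) (x : 'cV[R]_d) : R :=
  Num.sqrt (\sum_(i < d) x i ord0 ^+ 2).

(* Empty when r <= 0. *)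
Definition eball (R : realType) (d : nat) (x : 'cV[R]_d) (r : R) :
  set 'cV[R]_d := [set y | enorm (y - x) < r].

Definition orthogonal_group (R : realType) (d : nat) : set 'M[R]_d :=
  [set Theta | Theta^T *m Theta = 1%:M].

Section lebesgue_cV_step.
Variables (R : realType) (d : nat).
Variable m : {sigma_finite_measure set 'cV[R]_d -> \bar R}.

Definition cV_cons (p : measurableTypeR R * 'cV[R]_d) : 'cV[R]_d.+1 :=
  col_mx (const_mx p.1 : 'cV_1) p.2.

Definition cV_uncons (x : 'cV[R]_d.+1) : measurableTypeR R * 'cV[R]_d :=
  (x ord0 ord0, \col_i x (lift ord0 i) ord0).

Lemma cV_consK : cancel cV_cons cV_uncons.
Proof.
move=> [t v]; rewrite /cV_cons /cV_uncons/=; congr pair.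
  rewrite (_ : ord0 = lshift d (ord0 : 'I_1)); last exact: val_inj.
  by rewrite (@col_mxEu _ 1 d 1) mxE.
apply/colP => i; rewrite mxE.
rewrite (_ : lift ord0 i = rshift 1 i); last exact: val_inj.
by rewrite (@col_mxEd _ 1 d 1).
Qed.

Lemma measurable_cV_cons : measurable_fun setT cV_cons.
Proof.
apply: measurable_fun_cV => i; rewrite /cV_cons.
have [j ->|j ->] := @split_ordP 1 d i.
- rewrite (_ : (fun _ => _) = fst)//.
  by apply/funext => -[t v] /=; rewrite (@col_mxEu _ 1 d 1) mxE.
- rewrite (_ : (fun _ => _) = (fun x : 'cV[R]_d => x j ord0) \o snd).
    by apply: measurableT_comp => //; exact: measurable_coor.
  by apply/funext => -[t v] /=; rewrite (@col_mxEd _ 1 d 1).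
Qed.

Lemma measurable_cV_uncons : measurable_fun setT cV_uncons.
Proof.
apply/measurable_fun_pairP; split; first exact: measurable_coor.
apply: measurable_fun_cV => i.
rewrite (_ : (fun _ => _) = fun x : 'cV[R]_d.+1 => x (lift ord0 i) ord0).
  exact: measurable_coor.
by apply/funext => x /=; rewrite mxE.
Qed.

Definition lebesgue_cV_step : set 'cV[R]_d.+1 -> \bar R :=
  pushforward (@lebesgue_measure R \x m)%E cV_cons.

HB.instance Definition _ := Measure.copy lebesgue_cV_step
  (measure_function_pushforward__canonical__measure_function_Measure
     (@lebesgue_measure R \x m)%E measurable_cV_cons).

Let step_sigma_finite : sigma_finite setT lebesgue_cV_step.
Proof.
pose l : {sigma_finite_measure set (measurableTypeR R) -> \bar R} :=
  lebesgue_measure.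
have /sigma_finiteP[A [TA ndA Aoo]] := sigma_finiteT l.
have /sigma_finiteP[B [TB ndB Boo]] := sigma_finiteT m.
pose F n := A n `*` B n.
have FT : setT = \bigcup_n F n.
  rewrite -setXTT TA TB predeqE => -[x y]; split.
    move=> [/= [n _ Anx] [k _ Bky]]; exists (maxn n k) => //; split.
    - by move: x Anx; exact/subsetPset/ndA/leq_maxl.
    - by move: y Bky; exact/subsetPset/ndB/leq_maxr.
  by move=> [n _ []/= ? ?]; split; exists n.
have Foo k : measurable (F k) /\ ((@lebesgue_measure R \x m) (F k) < +oo)%E.
  have [mA Ak] := Aoo k; have [mB Bk] := Boo k.
  split; first exact: measurableX.
  by rewrite (product_measure1E l m)// lte_mul_pinfty// ge0_fin_numE.
exists (fun k => cV_uncons @^-1` F k).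
  by rewrite -preimage_bigcup -FT preimage_setT.
move=> k; have [mFk Fkoo] := Foo k; split.
  by rewrite -[X in measurable X]setTI; exact: measurable_cV_uncons.
rewrite /lebesgue_cV_step /pushforward -comp_preimage.
by rewrite (_ : cV_uncons \o cV_cons = id)//; apply/funext => p; exact: cV_consK.
Qed.

HB.instance Definition _ := Measure_isSigmaFinite.Build _ _ _
  lebesgue_cV_step step_sigma_finite.

End lebesgue_cV_step.

Fixpoint lebesgue_cV (R : realType) (d : nat) :
    {sigma_finite_measure set 'cV[R]_d -> \bar R} :=
  match d with
  | 0 => [the {sigma_finite_measure set 'cV[R]_0 -> \bar R} of \d_(0 : 'cV[R]_0)]
  | d'.+1 => [the {sigma_finite_measure set 'cV[R]_d'.+1 -> \bar R} of
               lebesgue_cV_step (lebesgue_cV R d')]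
  end.

Lemma measurable_box (R : realType) (d : nat) (A : 'I_d -> set R) :
  (forall i, measurable (A i)) ->
  measurable [set x : 'cV[R]_d | forall i, A i (x i ord0)].
Proof.
move=> mA.
rewrite (_ : [set _ | _] =
    \bigcap_(i in [set: 'I_d]) ((fun x : 'cV[R]_d => x i ord0) @^-1` A i)).
  apply: fin_bigcap_measurable => // i _.
  by rewrite -[X in measurable X]setTI; exact: measurable_coor.
by apply/seteqP; split => x /= h i => [_|]; exact: h.
Qed.

Lemma lebesgue_cV_box (R : realType) (d : nat) (A : 'I_d -> set R) :
  (forall i, measurable (A i)) ->
  lebesgue_cV R d [set x | forall i, A i (x i ord0)] =
  (\prod_(i < d) lebesgue_measure (A i))%E.
Proof.
elim: d A => [|d IH] A mA /=.
  by rewrite big_ord0 diracE mem_set// => -[].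
rewrite big_ord_recl -IH// /lebesgue_cV_step /pushforward.
rewrite -(product_measure1E _ (lebesgue_cV R d)) => //=.
  congr (product_measure1 _ _ _); apply/seteqP; split => -[t v] /=; rewrite /cV_cons/=.
  - move=> h; split => [|i].
      move: (h ord0); rewrite (_ : ord0 = lshift d (ord0 : 'I_1)); last exact: val_inj.
      by rewrite (@col_mxEu _ 1 d 1) mxE.
    move: (h (lift ord0 i)).
    rewrite [in X in A _ X -> _](_ : lift ord0 i = rshift 1 i); last exact: val_inj.
    by rewrite (@col_mxEd _ 1 d 1).
  - move=> [hA hB] i; case: (unliftP ord0 i) => [j|] ->.
      rewrite [X in A _ (_ X _)](_ : lift ord0 j = rshift 1 j); last exact: val_inj.
      by rewrite (@col_mxEd _ 1 d 1); exact: hB.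
    rewrite [X in A _ (_ X _)](_ : ord0 = lshift d (ord0 : 'I_1)); last exact: val_inj.
    by rewrite (@col_mxEu _ 1 d 1) mxE.
- exact: (mA ord0).
- exact: (measurable_box (A := fun i => A (lift ord0 i))).
Qed.

(* A [charge] takes finite values on measurable sets, hence has finite total
   variation. *)
Notation signed_measure R d := (charge 'cV[R]_d R).

Section image_charges.
Variables (R : realType) (d : nat).
Implicit Type mu : signed_measure R d.

Lemma measurable_translation (s : 'cV[R]_d) :
  measurable_fun setT (fun x : 'cV[R]_d => x + s).
Proof.
apply: measurable_fun_cV => i.
rewrite (_ : (fun _ => _) = (fun x : 'cV[R]_d => x i ord0 + s i ord0)).
  by apply: measurable_funD => //; exact: measurable_coor.
by apply/funext => x; rewrite mxE.
Qed.

Lemma measurable_mulmx (Theta : 'M[R]_d) :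
  measurable_fun setT (fun x : 'cV[R]_d => Theta *m x).
Proof.
apply: measurable_fun_cV => i.
rewrite (_ : (fun _ => _) =
    (fun x : 'cV[R]_d => \sum_(j < d) Theta i j * x j ord0)).
  apply: measurable_sum => j; apply: measurable_funM => //.
  exact: measurable_coor.
by apply/funext => x; rewrite mxE.
Qed.

Lemma measurable_dilation (a : R) :
  measurable_fun setT (fun x : 'cV[R]_d => a *: x).
Proof.
apply: measurable_fun_cV => i.
rewrite (_ : (fun _ => _) = (fun x : 'cV[R]_d => a * x i ord0)).
  by apply: measurable_funM => //; exact: measurable_coor.
by apply/funext => x; rewrite mxE.
Qed.

(* A |-> mu (A - s) *)
Definition translate (s : 'cV[R]_d) mu : set 'cV[R]_d -> \bar R :=
  pushforward mu (fun x => x + s).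

HB.instance Definition _ s mu := Charge.copy (translate s mu)
  (measure_function_pushforward__canonical__charge_Charge mu
     (measurable_translation s)).

(* A |-> mu (Theta^-1 A) *)
Definition rotate_charge (Theta : 'M[R]_d) mu : set 'cV[R]_d -> \bar R :=
  pushforward mu (fun x => Theta *m x).

HB.instance Definition _ Theta mu := Charge.copy (rotate_charge Theta mu)
  (measure_function_pushforward__canonical__charge_Charge mu
     (measurable_mulmx Theta)).

(* A |-> mu (a^-1 A) *)
Definition dilate (a : R) mu : set 'cV[R]_d -> \bar R :=
  pushforward mu (fun x => a *: x).

HB.instance Definition _ a mu := Charge.copy (dilate a mu)
  (measure_function_pushforward__canonical__charge_Charge mu
     (measurable_dilation a)).

End image_charges.

Definition ball_charge (R : realType) (d : nat) (mu : signed_measure R d)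
    (z : 'cV[R]_d * measurableTypeR R) : R :=
  fine (mu (eball z.1 z.2)).

Definition M_space (R : realType) (d : nat) (alpha beta : R) :
    set (signed_measure R d) :=
  [set mu | exists C p q : R, [/\ 0 < p, p < beta, beta < q &
    forall r : R, 0 < r ->
      (\int[lebesgue_cV R d]_x (`|ball_charge mu (x, r)| `^ alpha)%:E <=
       (C * Num.min (r `^ p) (r `^ q))%:E)%E]].

Definition cexp (R : realType) (z : R[i]) : R[i] :=
  ((expR (complex.Re z) * cos (complex.Im z))%R +i*
   (expR (complex.Re z) * sin (complex.Im z))%R)%C.

Section stable.
Context (R : realType) (dO : measure_display) (Omega : measurableType dO).
Variable P : probability Omega R.

Definition charfun (X : {RV P >-> R}) (theta : R) : R[i] :=
  (fine 'E_P[fun w => cos (theta * X w)%R] +i*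
   fine 'E_P[fun w => sin (theta * X w)%R])%C.

(* The law S_alpha(s, b, 0) of scale s, skewness b and shift 0; this is the form
   of its characteristic function for alpha <> 1. *)
Definition has_stable_law (alpha s b : R) (X : {RV P >-> R}) : Prop :=
  forall theta : R, charfun X theta =
    cexp (- ((s `^ alpha * `|theta| `^ alpha)%:C *
             (1 -i* (b * Num.sg theta * tan (pi * alpha / 2))%R)))%C.

Definition mutually_independent (n : nat) (X : 'I_n -> {RV P >-> R}) : Prop :=
  forall B : 'I_n -> set R, (forall i, measurable (B i)) ->
    P (\bigcap_i (X i @^-1` B i)) = (\prod_(i < n) P (X i @^-1` B i))%E.

Definition cvg_in_probability (Y : (Omega -> R)^nat) (X : Omega -> R) : Prop :=
  forall e : R, 0 < e ->
    P [set w | e <= `|Y n w - X w|] @[n --> \oo] --> 0%E.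

Section random_measure.
Context (dE : measure_display) (E : measurableType dE).
Variable m : {measure set E -> \bar R}.

Definition finite_measure_sets : set (set E) :=
  [set A | measurable A /\ (m A < +oo)%E].

(* Independently scattered, a.s. sigma-additive, with M A of law
   S_alpha(m(A)^(1/alpha), b, 0); the skewness intensity is the constant b.
   The values of M outside [finite_measure_sets] are irrelevant. *)
Record stable_random_measure (alpha b : R) (M : set E -> {RV P >-> R}) : Prop := {
  srm_independently_scattered : forall (n : nat) (A : 'I_n -> set E),
    (forall i, finite_measure_sets (A i)) -> trivIset setT A ->
    mutually_independent (fun i => M (A i)) ;
  srm_sigma_additive : forall A : (set E)^nat,
    (forall i, finite_measure_sets (A i)) -> trivIset setT A ->
    finite_measure_sets (\bigcup_i A i) ->
    {ae P, forall w, \sum_(0 <= i < n) M (A i) w @[n --> \oo] -->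
                     M (\bigcup_i A i) w} ;
  srm_law : forall A : set E, finite_measure_sets A ->
    has_stable_law alpha (fine (m A) `^ alpha^-1) b (M A)
}.

(* When g is in L^alpha(m), only the level set of c = 0 may have infinite
   measure, and its term vanishes. *)
Definition simple_stable_integral (M : set E -> {RV P >-> R})
    (g : {sfun E >-> R}) (w : Omega) : R :=
  \sum_(c \in range g) c * M (g @^-1` [set c]) w.

(* Y is a version of the integral of f: the limit in probability of the integrals
   of simple functions converging to f in L^alpha(m). *)
Definition is_stable_integral (alpha : R) (M : set E -> {RV P >-> R})
    (f : E -> R) (Y : {RV P >-> R}) : Prop :=
  f \in Lfun m alpha%:E /\
  exists g : {sfun E >-> R}^nat,
    [/\ forall n, (g n : E -> R) \in Lfun m alpha%:E,
        ('N[m]_(alpha%:E)[EFin \o (g n \- f)%R])%E @[n --> \oo] --> 0%E &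
        cvg_in_probability (fun n => simple_stable_integral M (g n)) Y].

End random_measure.

Definition same_fdd (I : Type) (D : set I) (X Y : I -> Omega -> R) : Prop :=
  forall (n : nat) (t : 'I_n -> I), (forall k, D (t k)) ->
  forall B : set (n.-tuple R), measurable B ->
    P [set w | B [tuple X (t k) w | k < n]] =
    P [set w | B [tuple Y (t k) w | k < n]].

End stable.

(* The measure on R^d x (0, +oo), carried by R^d x R: it does not charge
   r <= 0. *)
Section control_measure.
Local Open Scope ereal_scope.
Variables (R : realType) (d : nat) (alpha beta : R) (sigma C : {posnum R}).

Definition control_measure (A : set ('cV[R]_d * measurableTypeR R)) : \bar R :=
  \int[lebesgue_cV R d \x lebesgue_measure]_(z in A `&` [set z | (0 < z.2)%R])
    (sigma%:num `^ alpha * C%:num * z.2 `^ (- 1 - beta))%:E.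

Let mpos : measurable [set z : 'cV[R]_d * measurableTypeR R | (0 < z.2)%R].
Proof.
rewrite (_ : [set _ | _] = snd @^-1` `]0%R, +oo[%classic); last first.
  by apply/seteqP; split => z /=; rewrite in_itv/= andbT.
by rewrite -[X in measurable X]setTI; exact: measurable_snd.
Qed.

Let control0 : control_measure set0 = 0.
Proof. by rewrite /control_measure set0I integral_set0. Qed.

Let control_ge0 A : 0 <= control_measure A.
Proof.
by apply: integral_ge0 => z _; rewrite lee_fin !mulr_ge0// powR_ge0.
Qed.

Let control_sigma_additive : semi_sigma_additive control_measure.
Proof.
move=> F mF tF mUF; rewrite /control_measure setI_bigcupl.
rewrite (@ge0_integral_bigcup _ _ _ (lebesgue_cV R d \x lebesgue_measure))//=.
- apply: is_cvg_ereal_nneg_natsum_cond => n _ _.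
  by apply: integral_ge0 => z _; rewrite lee_fin !mulr_ge0// powR_ge0.
- by move=> k; exact: measurableI.
- apply: measurable_funTS; apply/measurable_EFinP; apply: measurable_funM => //.
  exact: (measurableT_comp (measurable_powR (-1 - beta))).
- by move=> z _; rewrite lee_fin !mulr_ge0// powR_ge0.
- exact: trivIset_setIr.
Qed.

HB.instance Definition _ := isMeasure.Build _ _ _ control_measure
  control0 control_ge0 control_sigma_additive.

End control_measure.

Arguments control_measure {R} d alpha beta sigma C A.

(* Main.v *)
Require Import Defs.
From HB Require Import structures.
From mathcomp Require Import all_boot all_order all_algebra.
From mathcomp Require Import all_classical all_reals all_analysis.
From mathcomp Require Import measurable_realfun lra ring.

Set Implicit Arguments.
Unset Strict Implicit.
Unset Printing Implicit Defensive.

Import Order.TTheory GRing.Theory Num.Theory.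
Import numFieldNormedType.Exports.

Local Open Scope classical_set_scope.
Local Open Scope ring_scope.

(** The field is invariant because the three operations on charges are changes
    of variables on the half space, $\mu(B(x,r))$ becoming $\mu(B(Tx,cr))$ with
    $T$ a translation, a rotation or a dilation, and because such a change of
    variables multiplies the control measure $r^{-1-\beta}\,dr\,dx$ by a constant
    $\kappa$ ([rescales_control_measure]): $\kappa=1$ for translations and
    rotations, and $\kappa=a^{d-\beta}$ for the dilation by $a$.

    The law of a linear combination $\sum_k\theta_k Z(\mu_k)$ depends only on
    the integrals of $(h^+)^\alpha$ and $(h^-)^\alpha$ for the control measure,
    where $h(x,r)=\sum_k\theta_k\mu_k(B(x,r))$.  More precisely its
    characteristic function is an explicit function of these two integrals
    ([stable_integral_cf]).  The change of variables multiplies both by $\kappa$,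
    and so does the multiplication of the field by $\kappa^{1/\alpha}$; equality
    of the finite-dimensional distributions follows, since the joint
    characteristic function determines the joint law ([equal_laws]).

    The formula for the characteristic function comes from simple functions: on
    the common level sets of finitely many simple functions, the integrals are
    combinations of independent stable variables ([simple_stable_cf]).  The
    general case is a limit in probability on one side and in $L^\alpha$ on the
    other.

    That characteristic functions determine laws is obtained without Fourier
    inversion.  Trigonometric polynomials form an algebra, which contains
    polynomials in $\cos(\omega(x_i-a_i))$; suitable bounded sequences of these
    converge to indicators of level sets of the cosines, and letting $\omega$
    tend to 0 yields indicators of boxes.

    Invariance of Lebesgue measure under rotations rests on the uniqueness of
    translation invariant measures up to a factor, in the form of a symmetric
    identity that Fubini's theorem provides
    ([translation_invariant_product]). *)

(** * Expectations of bounded functions *)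

Section cos_sin_bounded.
Variable R : realType.

Lemma norm_cos_le1 (x : R) : `|cos x| <= 1.
Proof. by rewrite ler_norml cos_geN1 cos_le1. Qed.

Lemma norm_sin_le1 (x : R) : `|sin x| <= 1.
Proof. by rewrite ler_norml sin_geN1 sin_le1. Qed.

Lemma measurable_cos : measurable_fun setT (@cos R).
Proof. by apply: continuous_measurable_fun; exact: continuous_cos. Qed.

Lemma measurable_sin : measurable_fun setT (@sin R).
Proof. by apply: continuous_measurable_fun; exact: continuous_sin. Qed.

End cos_sin_bounded.

Section bounded_expectation.
Context (R : realType) (dO : measure_display) (Omega : measurableType dO).
Variable P : probability Omega R.
Implicit Types f g : Omega -> R.

Definition bdd_measurable f :=
  measurable_fun setT f /\ exists K : R, forall w, `|f w| <= K.

Lemma bdd_measurable_fun f : bdd_measurable f -> measurable_fun setT f.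
Proof. by case. Qed.

Lemma bdd_cst (c : R) : bdd_measurable (fun=> c).
Proof. by split => //; exists `|c|. Qed.

Lemma bddD f g : bdd_measurable f -> bdd_measurable g ->
  bdd_measurable (fun w => f w + g w).
Proof.
move=> [mf [K fK]] [mg [L gL]]; split; first exact: measurable_funD.
by exists (K + L) => w; rewrite (le_trans (ler_normD _ _))// lerD.
Qed.

Lemma bddM f g : bdd_measurable f -> bdd_measurable g ->
  bdd_measurable (fun w => f w * g w).
Proof.
move=> [mf [K fK]] [mg [L gL]]; split; first exact: measurable_funM.
by exists (K * L) => w; rewrite normrM ler_pM.
Qed.

Lemma bddZ (c : R) f : bdd_measurable f -> bdd_measurable (fun w => c * f w).
Proof. by move=> bf; apply: bddM => //; exact: bdd_cst. Qed.

Lemma bddB f g : bdd_measurable f -> bdd_measurable g ->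
  bdd_measurable (fun w => f w - g w).
Proof.
move=> bf bg; rewrite (_ : (fun _ => _) = (fun w => f w + (-1) * g w)).
  by apply: bddD => //; exact: bddZ.
by apply/funext => w; rewrite mulN1r.
Qed.

Lemma bdd_sum I (s : seq I) (p : pred I) (F : I -> Omega -> R) :
  (forall i, p i -> bdd_measurable (F i)) ->
  bdd_measurable (fun w => \sum_(i <- s | p i) F i w).
Proof.
move=> bF; elim: s => [|i s IH].
  rewrite (_ : (fun _ => _) = fun=> 0); first exact: bdd_cst.
  by apply/funext => w; rewrite big_nil.
have [pi|npi] := boolP (p i).
  rewrite (_ : (fun _ => _) = fun w => F i w + \sum_(j <- s | p j) F j w).
    by apply: bddD => //; exact: bF.
  by apply/funext => w; rewrite big_cons pi.
rewrite (_ : (fun _ => _) = fun w => \sum_(j <- s | p j) F j w)//.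
by apply/funext => w; rewrite big_cons (negbTE npi).
Qed.

Lemma bdd_cos f : measurable_fun setT f -> bdd_measurable (fun w => cos (f w)).
Proof.
move=> mf; split; last by exists 1 => w; exact: norm_cos_le1.
by apply: measurableT_comp => //; exact: measurable_cos.
Qed.

Lemma bdd_sin f : measurable_fun setT f -> bdd_measurable (fun w => sin (f w)).
Proof.
move=> mf; split; last by exists 1 => w; exact: norm_sin_le1.
by apply: measurableT_comp => //; exact: measurable_sin.
Qed.

Lemma bdd_indic (A : set Omega) : measurable A -> bdd_measurable (\1_A : Omega -> R).
Proof.
move=> mA; split; first exact: measurable_indic.
by exists 1 => w; rewrite indicE; case: (_ \in _); rewrite ?normr1// normr0.
Qed.

Lemma integrable_bdd f : bdd_measurable f -> P.-integrable setT (EFin \o f).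
Proof.
move=> [mf [K fK]].
apply: (@le_integrable _ _ _ P _ measurableT _ (fun=> K%:E)).
- exact/measurable_EFinP.
- by move=> w _ /=; rewrite lee_fin (le_trans (fK w))// ler_norm.
- exact: finite_measure_integrable_cst.
Qed.

Local Notation Ex f := (Rintegral P setT f).

Lemma ExD f g : bdd_measurable f -> bdd_measurable g ->
  Ex (fun w => f w + g w) = Ex f + Ex g.
Proof. by move=> bf bg; rewrite RintegralD//; exact: integrable_bdd. Qed.

Lemma ExB f g : bdd_measurable f -> bdd_measurable g ->
  Ex (fun w => f w - g w) = Ex f - Ex g.
Proof. by move=> bf bg; rewrite RintegralB//; exact: integrable_bdd. Qed.

Lemma ExZ (c : R) f : bdd_measurable f -> Ex (fun w => c * f w) = c * Ex f.
Proof. by move=> bf; rewrite RintegralZl//; exact: integrable_bdd. Qed.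

Lemma Ex_sum I (s : seq I) (F : I -> Omega -> R) :
  (forall i, bdd_measurable (F i)) ->
  Ex (fun w => \sum_(i <- s) F i w) = \sum_(i <- s) Ex (F i).
Proof.
move=> bF; elim: s => [|i s IH].
  rewrite big_nil; under eq_Rintegral do rewrite big_nil.
  by rewrite Rintegral_cst// mul0r.
rewrite big_cons -IH -ExD//; last exact: bdd_sum.
by apply: eq_Rintegral => w _; rewrite big_cons.
Qed.

Lemma Ex_indic (A : set Omega) : measurable A -> Ex (\1_A : Omega -> R) = fine (P A).
Proof. by move=> mA; rewrite /Rintegral integral_indic// setIT. Qed.

Lemma le_Ex f g : bdd_measurable f -> bdd_measurable g ->
  (forall w, f w <= g w) -> Ex f <= Ex g.
Proof.
move=> bf bg fg; apply: le_Rintegral => //; exact: integrable_bdd.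
Qed.

Lemma norm_Ex_le f : bdd_measurable f -> `|Ex f| <= Ex (fun w => `|f w|).
Proof. by move=> bf; apply: le_normr_Rintegral => //; exact: integrable_bdd. Qed.

Lemma ae_eq_Ex f g : measurable_fun setT f -> measurable_fun setT g ->
  {ae P, forall w, f w = g w} -> Ex f = Ex g.
Proof.
move=> mf mg fg; congr fine; apply: ae_eq_integral => //.
- exact/measurable_EFinP.
- exact/measurable_EFinP.
- by apply: filterS fg => w -> _.
Qed.

Lemma bounded_convergence (u : (Omega -> R)^nat) f (K : R) :
  (forall n, measurable_fun setT (u n)) -> (forall n w, `|u n w| <= K) ->
  measurable_fun setT f -> (forall w, u n w @[n --> \oo] --> f w) ->
  Ex (u n) @[n --> \oo] --> Ex f.
Proof.
move=> mu uK mf uf.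
have [|||||intf _ h] := @dominated_convergence _ _ _ P setT measurableT
  (fun n => EFin \o u n) (EFin \o f) (fun=> K%:E).
- by move=> n; exact/measurable_EFinP.
- exact/measurable_EFinP.
- by apply: aeW => w _; apply: cvg_EFin; [exact: nearW|exact: uf].
- exact: finite_measure_integrable_cst.
- by apply: aeW => w n _ /=; rewrite lee_fin.
apply: fine_cvg; rewrite fineK//.
exact: integrable_fin_num.
Qed.

End bounded_expectation.
Notation Ex P f := (Rintegral P setT f).

(** * Steps and open boxes as limits of trigonometric polynomials *)

Section bernoulli_steps.
Variable R : realType.
Implicit Types (t v x : R) (m : nat).

Lemma bernoulli_ge m t : 0 <= t <= 1 -> 1 - m%:R * t <= (1 - t) ^+ m.
Proof.
move=> /andP[t0 t1]; elim: m => [|m IH]; first by rewrite mul0r subr0 expr0.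
rewrite exprSr (le_trans _ (ler_wpM2r _ IH)) ?subr_ge0// -natr1.
have : 0 <= m%:R * t ^+ 2 by rewrite mulr_ge0// sqr_ge0.
set n := m%:R; lra.
Qed.

Lemma bernoulli_le m t : 0 <= t <= 1 -> (1 - t) ^+ m * (1 + m%:R * t) <= 1.
Proof.
move=> /andP[t0 t1]; elim: m => [|m IH]; first by rewrite mul0r addr0 expr0 mulr1.
rewrite exprSr -mulrA (le_trans _ IH)// ler_wpM2l ?exprn_ge0 ?subr_ge0//.
have : 0 <= m%:R * t ^+ 2 by rewrite mulr_ge0// sqr_ge0.
have : 0 <= t ^+ 2 by rewrite sqr_ge0.
rewrite -natr1; set n := m%:R; lra.
Qed.

Lemma cvg_natr_mul_expr x : 0 <= x < 1 -> m%:R * x ^+ m @[m --> \oo] --> (0 : R).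
Proof.
move=> /andP[x0 x1]; pose y := Num.sqrt x; pose t := 1 - y.
have y1 : y < 1 by rewrite -[ltRHS]sqrtr1 ltr_sqrt.
have y0 : 0 <= y by exact: sqrtr_ge0.
have t0 : 0 < t by rewrite subr_gt0.
apply: (@squeeze_cvgr _ _ _ _ (fun=> 0) (fun m => t^-1 * y ^+ m)).
- near=> m; rewrite mulr_ge0 ?exprn_ge0//=.
  rewrite -(sqr_sqrtr x0) -/y -exprM mul2n -addnn exprD mulrA.
  rewrite ler_wpM2r ?exprn_ge0// -(ler_pM2r t0) mulVf ?gt_eqF//.
  have : 0 <= t <= 1 by rewrite ltW//= lerBlDr lerDl.
  move=> /(bernoulli_le m); apply: le_trans.
  by rewrite [1 - t]subKr mulrAC mulrC ler_wpM2l ?exprn_ge0// lerDr.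
- exact: cvg_cst.
- rewrite -[X in _ --> X](mulr0 t^-1); apply: cvgMr.
  by apply: cvg_expr; rewrite ger0_norm.
Unshelve. all: by end_near. Qed.

(** Bernoulli's inequalities bound this polynomial by $1 - m(2v)^m$ from below
    and by $(1 + m(2v)^m)^{-1}$ from above, so on $[0,1]$ it tends to the
    indicator of $v < 1/2$.  With the exponent $2^m$ the limit at $1/2$ would be
    $e^{-1}$; the factor $m$ makes it 0. *)
Definition step_poly (m : nat) (v : R) : R := (1 - v ^+ m) ^+ (m * 2 ^ m).

Lemma step_poly_itv m v : 0 <= v <= 1 -> 0 <= step_poly m v <= 1.
Proof.
move=> /andP[v0 v1]; have /andP[? ?] : 0 <= v ^+ m <= 1.
  by rewrite exprn_ge0// exprn_ile1.
by rewrite exprn_ge0 ?exprn_ile1 ?subr_ge0// gerBl.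
Qed.

Lemma cvg_step_poly v : 0 <= v <= 1 ->
  step_poly m v @[m --> \oo] --> ((v < 2^-1)%R%:R : R).
Proof.
move=> /andP[v0 v1].
have vm m : 0 <= v ^+ m <= 1 by rewrite exprn_ge0// exprn_ile1.
have E m : (m * 2 ^ m)%:R * v ^+ m = m%:R * (2 * v) ^+ m.
  by rewrite natrM natrX exprMn mulrA.
have [v2|v2] := ltP v 2^-1.
- apply: (@squeeze_cvgr _ _ _ _ (fun m => 1 - m%:R * (2 * v) ^+ m) (fun=> 1)).
  + near=> m; have /andP[_ ->] := step_poly_itv m (introT andP (conj v0 v1)).
    by rewrite andbT -E; exact: bernoulli_ge.
  + rewrite -[X in _ --> X]subr0; apply: cvgB; first exact: cvg_cst.
    by apply: cvg_natr_mul_expr; lra.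
  + exact: cvg_cst.
- apply: (@squeeze_cvgr _ _ _ _ (fun=> 0) (@harmonic R)).
  + near=> m; have /andP[-> _] := step_poly_itv m (introT andP (conj v0 v1)).
    rewrite /= /step_poly -[leRHS]mul1r ler_pdivlMr ?ltr0n//.
    apply: le_trans (bernoulli_le (m * 2 ^ m) (vm m)).
    rewrite ler_wpM2l ?exprn_ge0 ?subr_ge0//; first by case/andP : (vm m).
    rewrite E -natr1 addrC lerD2l ler_peMr// exprn_ege1//; lra.
  + exact: cvg_cst.
  + exact: cvg_harmonic.
Unshelve. all: by end_near. Qed.

End bernoulli_steps.

Section trigonometric_polynomials.
Variables (R : realType) (n : nat).
Implicit Types (x : 'I_n -> R) (f g : ('I_n -> R) -> R).

(** The phase $c$ puts sines and cosines on the same footing, and makes the span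
    an algebra that contains the constants. *)
Inductive trig_poly : (('I_n -> R) -> R) -> Prop :=
| trig_cos (c : R) (th : 'I_n -> R) :
    trig_poly (fun x => cos (c + \sum_i th i * x i))
| trig_add f g : trig_poly f -> trig_poly g -> trig_poly (fun x => f x + g x)
| trig_scale a f : trig_poly f -> trig_poly (fun x => a * f x).

Lemma trig_cst c : trig_poly (fun=> c).
Proof.
rewrite (_ : (fun=> c) =
    (fun x => c * cos (0 + \sum_i (fun=> 0 : R) i * x i))).
  exact/trig_scale/trig_cos.
by apply/funext => x; rewrite big1 ?addr0 ?cos0 ?mulr1// => i _; rewrite mul0r.
Qed.

(** Closure under products is the formula
    $2\cos a\cos b = \cos(a+b)+\cos(a-b)$. *)
Lemma trig_mul f g : trig_poly f -> trig_poly g -> trig_poly (fun x => f x * g x).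
Proof.
move=> tf tg; elim: tf => {f} [c th|f1 f2 _ IH1 _ IH2|a f _ IH].
- elim: tg => {g} [c' th'|g1 g2 _ IH1 _ IH2|a g _ IH].
  + pose F (s : R) x := cos ((c + s * c') + \sum_i (th i + s * th' i) * x i).
    rewrite (_ : (fun _ => _) = (fun x => 2^-1 * (F 1 x + F (-1) x))).
      by apply: trig_scale; apply: trig_add; exact: trig_cos.
    apply/funext => x; rewrite /F.
    have E s : c + s * c' + \sum_i (th i + s * th' i) * x i =
        (c + \sum_i th i * x i) + s * (c' + \sum_i th' i * x i).
      rewrite mulrDr addrACA mulr_sumr -big_split/=; congr (_ + _).
      by apply: eq_bigr => i _; rewrite mulrDl mulrA.
    rewrite !E mul1r mulN1r; set u := c + _; set v := c' + _.
    by rewrite cosD cosB; field.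
  + rewrite (_ : (fun _ => _) = (fun x => cos (c + \sum_i th i * x i) * g1 x +
      cos (c + \sum_i th i * x i) * g2 x)); first exact: trig_add.
    by apply/funext => x; rewrite mulrDr.
  + rewrite (_ : (fun _ => _) =
      (fun x => a * (cos (c + \sum_i th i * x i) * g x))); first exact: trig_scale.
    by apply/funext => x; rewrite mulrCA.
- rewrite (_ : (fun _ => _) = (fun x => f1 x * g x + f2 x * g x)).
    exact: trig_add.
  by apply/funext => x; rewrite mulrDl.
- rewrite (_ : (fun _ => _) = (fun x => a * (f x * g x))); first exact: trig_scale.
  by apply/funext => x; rewrite mulrA.
Qed.

Lemma trig_expr f m : trig_poly f -> trig_poly (fun x => f x ^+ m).
Proof.
move=> tf; elim: m => [|m IH].
  by rewrite (_ : (fun _ => _) = fun=> 1)//; exact: trig_cst.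
rewrite (_ : (fun _ => _) = (fun x => f x * f x ^+ m)); first exact: trig_mul.
by apply/funext => x; rewrite exprS.
Qed.

Lemma trig_prod I (s : seq I) (F : I -> ('I_n -> R) -> R) :
  (forall i, trig_poly (F i)) -> trig_poly (fun x => \prod_(i <- s) F i x).
Proof.
move=> tF; elim: s => [|i s IH].
  rewrite (_ : (fun _ => _) = fun=> 1); first exact: trig_cst.
  by apply/funext => x; rewrite big_nil.
rewrite (_ : (fun _ => _) = (fun x => F i x * \prod_(j <- s) F j x)).
  exact: trig_mul.
by apply/funext => x; rewrite big_cons.
Qed.

Lemma trig_affine f a c : trig_poly f -> trig_poly (fun x => a + c * f x).
Proof. by move=> tf; apply: trig_add; [exact: trig_cst|exact: trig_scale]. Qed.

Lemma trig_step_poly f m : trig_poly f -> trig_poly (fun x => step_poly m (f x)).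
Proof.
move=> tf; apply: trig_expr.
rewrite (_ : (fun _ => _) = (fun x => 1 + (-1) * f x ^+ m)).
  exact/trig_affine/trig_expr.
by apply/funext => x; rewrite mulN1r.
Qed.

Lemma trig_cos_coord i (om a : R) : trig_poly (fun x => cos (om * (x i - a))).
Proof.
rewrite (_ : (fun _ => _) = (fun x =>
    cos (- (om * a) + \sum_j (om *+ (j == i)) * x j))); first exact: trig_cos.
apply/funext => x; congr cos; rewrite (bigD1 i)//= eqxx mulr1n big1 ?addr0.
  by rewrite mulrBr addrC.
by move=> j /negbTE ->; rewrite mulr0n mul0r.
Qed.

End trigonometric_polynomials.

(** * Equality of laws from equality of characteristic functions *)

Section equal_laws.
Context (R : realType) (dO : measure_display) (Omega : measurableType dO).
Variables (P : probability Omega R) (n : nat) (X Y : 'I_n -> Omega -> R).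
Hypothesis mX : forall i, measurable_fun setT (X i).
Hypothesis mY : forall i, measurable_fun setT (Y i).

Definition same_expectation (h : ('I_n -> R) -> R) :=
  [/\ bdd_measurable (fun w => h (X ^~ w)), bdd_measurable (fun w => h (Y ^~ w)) &
      Ex P (fun w => h (X ^~ w)) = Ex P (fun w => h (Y ^~ w))].

(** The functions with the same expectation at $X$ and at $Y$ need not form an
    algebra; the products are taken among trigonometric polynomials, and only
    limits are taken in this larger class. *)
Lemma same_expectation_lim (u : (('I_n -> R) -> R)^nat) (h : ('I_n -> R) -> R) (K : R) :
  (forall m, same_expectation (u m)) -> (forall m x, `|u m x| <= K) ->
  (forall x, u m x @[m --> \oo] --> h x) -> same_expectation h.
Proof.
move=> su uK uh.
have hK x : `|h x| <= K.
  have cu : `|u m x| @[m --> \oo] --> `|h x| by apply: cvg_norm; exact: uh.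
  rewrite -(cvg_lim _ cu)//.
  by apply: limr_le; [exact: cvgP cu|exact: nearW].
have aux (Z : 'I_n -> Omega -> R) :
    (forall m, bdd_measurable (fun w => u m (Z ^~ w))) ->
    bdd_measurable (fun w => h (Z ^~ w)) /\
    Ex P (fun w => u m (Z ^~ w)) @[m --> \oo] --> Ex P (fun w => h (Z ^~ w)).
  move=> bu.
  have mh : measurable_fun setT (fun w => h (Z ^~ w)).
    apply: (measurable_fun_cvg (h := fun m w => u m (Z ^~ w))).
      by move=> m; apply: bdd_measurable_fun.
    by move=> w _; exact: uh.
  split; first by split => //; exists K.
  apply: (@bounded_convergence _ _ _ P (fun m w => u m (Z ^~ w)) _ K) => //.
  by move=> m; apply: bdd_measurable_fun.
have [bX EX] := aux X (fun m => let: And3 b _ _ := su m in b).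
have [bY EY] := aux Y (fun m => let: And3 _ b _ := su m in b).
split => //; rewrite -(cvg_lim _ EX)// -(cvg_lim _ EY)//.
by congr (lim (_ @ \oo)); apply/funext => m; case: (su m).
Qed.

Hypothesis XY_cos : forall th : 'I_n -> R,
  Ex P (fun w => cos (\sum_i th i * X i w)) =
  Ex P (fun w => cos (\sum_i th i * Y i w)).
Hypothesis XY_sin : forall th : 'I_n -> R,
  Ex P (fun w => sin (\sum_i th i * X i w)) =
  Ex P (fun w => sin (\sum_i th i * Y i w)).

Let mlin (Z : 'I_n -> Omega -> R) (th : 'I_n -> R) :
  (forall i, measurable_fun setT (Z i)) ->
  measurable_fun setT (fun w => \sum_i th i * Z i w).
Proof. by move=> mZ; apply: measurable_sum => i; exact: measurable_funM. Qed.

Lemma same_expectation_trig f : trig_poly f -> same_expectation f.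
Proof.
elim=> {f} [c th|f g _ [bX bY E] _ [bX' bY' E']|a f _ [bX bY E]].
- have E (Z : 'I_n -> Omega -> R) : (forall i, measurable_fun setT (Z i)) ->
      Ex P (fun w => cos (c + \sum_i th i * Z i w)) =
      cos c * Ex P (fun w => cos (\sum_i th i * Z i w)) -
      sin c * Ex P (fun w => sin (\sum_i th i * Z i w)).
    move=> mZ; have bc := bdd_cos (mlin th mZ); have bs := bdd_sin (mlin th mZ).
    rewrite -!ExZ// -ExB//; try exact: bddZ.
    by apply: eq_Rintegral => w _; rewrite cosD.
  split; last by rewrite !E// XY_cos XY_sin.
  + by apply: bdd_cos; apply: measurable_funD => //; exact: mlin.
  + by apply: bdd_cos; apply: measurable_funD => //; exact: mlin.
- split; [exact: bddD|exact: bddD|].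
  by rewrite !ExD// E E'.
- split; [exact: bddZ|exact: bddZ|].
  by rewrite !ExZ// E.
Qed.

Lemma cvg_prodr I (s : seq I) (u : I -> R^nat) (l : I -> R) :
  (forall i, u i m @[m --> \oo] --> l i) ->
  \prod_(i <- s) u i m @[m --> \oo] --> \prod_(i <- s) l i.
Proof.
move=> ul; elim: s => [|i s IH].
  rewrite big_nil; under eq_fun do rewrite big_nil.
  exact: cvg_cst.
rewrite big_cons; under eq_fun do rewrite big_cons.
exact: cvgM.
Qed.

Lemma normr_prod_le1 I (s : seq I) (F : I -> R) :
  (forall i, 0 <= F i <= 1) -> `|\prod_(i <- s) F i| <= 1.
Proof.
move=> F01; elim/big_ind: _ => [|x y x1 y1|i _]; first by rewrite normr1.
- by rewrite normrM mulr_ile1.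
- by case/andP: (F01 i) => F0 F1; rewrite ger0_norm.
Qed.

Lemma boolr_itv (b : bool) : 0 <= (b%:R : R) <= 1.
Proof. by case: b; rewrite ?ler01 lexx// ler01. Qed.

Let bump (om de a t : R) := (cos (om * de) < cos (om * (t - a)))%R.

(** The affine image of the cosine with values in $[0,1]$ that is below $1/2$
    exactly where $\cos(\omega(x-a)) > \cos(\omega\delta)$ turns the step
    polynomials into trigonometric polynomials that approximate the indicator of
    a periodic union of intervals. *)
Lemma same_expectation_bump (om : R) (a de : 'I_n -> R) :
  same_expectation (fun x => \prod_i (bump om (de i) (a i) (x i))%:R).
Proof.
pose v i x : R := (2^-1 + 4^-1 * cos (om * de i)) +
  (- 4^-1) * cos (om * (x i - a i)).
have v01 i x : 0 <= v i x <= 1.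
  have := cos_le1 (om * de i); have := cos_geN1 (om * de i).
  have := cos_le1 (om * (x i - a i)); have := cos_geN1 (om * (x i - a i)).
  rewrite /v; set p := cos _; set q := cos _; lra.
pose u m x := \prod_i step_poly m (v i x).
apply: (@same_expectation_lim u _ 1).
- move=> m; apply: same_expectation_trig; apply: trig_prod => i.
  by apply: trig_step_poly; apply: trig_affine; exact: trig_cos_coord.
- by move=> m x; apply: normr_prod_le1 => i; exact: step_poly_itv.
- move=> x; apply: cvg_prodr => i.
  rewrite (_ : bump _ _ _ _ = (v i x < 2^-1)%R); first exact: cvg_step_poly.
  rewrite /bump /v; set p := cos _; set q := cos _.
  by apply/idP/idP; lra.
Qed.

Let bump_small (om de a t : R) : 0 < om -> 0 <= de ->
  om * de < pi -> om * `|t - a| < pi -> bump om de a t = (`|t - a| < de)%R.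
Proof.
move=> om0 de0 h1 h2; rewrite /bump -(cos_norm (om * (t - a))) normrM gtr0_norm//.
rewrite ltr_cos ?ltr_pM2l// in_itv/=; apply/andP; split; try exact: ltW.
- by rewrite mulr_ge0// ltW.
- by rewrite mulr_ge0// ltW.
Qed.

(** When the frequency tends to 0, the period tends to infinity, and of the
    periodic union of intervals only the one around $a$ remains. *)
Lemma same_expectation_ball (a de : 'I_n -> R) : (forall i, 0 <= de i) ->
  same_expectation (fun x => \prod_i (`|x i - a i| < de i)%R%:R).
Proof.
move=> de0.
apply: (@same_expectation_lim
  (fun k x => \prod_i (bump k.+1%:R^-1 (de i) (a i) (x i))%:R) _ 1).
- by move=> k; exact: same_expectation_bump.
- by move=> k x; apply: normr_prod_le1 => i; exact: boolr_itv.
- move=> x; apply: cvg_prodr => i; apply: cvg_near_cst.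
  have h (c : R) : \forall k \near \oo, k.+1%:R^-1 * c < pi.
    have : k.+1%:R^-1 * c @[k --> \oo] --> (0 * c : R).
      by apply: cvgMl; exact: cvg_harmonic.
    rewrite mul0r => /cvgrPdist_lt/(_ pi (pi_gt0 R)); apply: filterS => k.
    by rewrite sub0r normrN; apply: le_lt_trans; exact: ler_norm.
  near=> k; rewrite bump_small ?invr_gt0//.
  + by near: k; exact: h.
  + by near: k; exact: h.
Unshelve. all: by end_near. Qed.

Let box (p q : 'I_n -> R) : set (n.-tuple R) :=
  [set t | forall i, p i < tnth t i < q i].

Let measurable_box p q : measurable (box p q).
Proof.
rewrite (_ : box p q = \bigcap_(i in [set: 'I_n])
    ((@tnth n R)^~ i @^-1` `]p i, q i[%classic)).
  apply: fin_bigcap_measurable => // i _.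
  by rewrite -[X in measurable X]setTI; exact: measurable_tnth.
apply/seteqP; split => t h i; first by move=> _; rewrite /= in_itv; exact: h.
by have := h i I; rewrite /= in_itv.
Qed.

Let measurable_tupleR (Z : 'I_n -> Omega -> R) :
  (forall i, measurable_fun setT (Z i)) ->
  measurable_fun setT (fun w => [tuple Z k w | k < n]).
Proof.
move=> mZ; apply/measurable_fun_tnthP => i.
by rewrite (_ : _ \o _ = Z i)//; apply/funext => w /=; rewrite tnth_mktuple.
Qed.

Let same_box p q :
  P [set w | box p q [tuple X k w | k < n]] =
  P [set w | box p q [tuple Y k w | k < n]].
Proof.
have preE (Z : 'I_n -> Omega -> R) : [set w | box p q [tuple Z k w | k < n]] =
    (fun w => [tuple Z k w | k < n]) @^-1` box p q by [].
have [/existsP[i qpi]|] := boolP [exists i, q i <= p i].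
  have box0 (Z : 'I_n -> Omega -> R) :
      [set w | box p q [tuple Z k w | k < n]] = set0.
    apply/seteqP; split => // w /= /(_ i) /andP[h1 h2].
    by have := lt_trans h1 h2; rewrite ltNge qpi.
  by rewrite !box0.
rewrite negb_exists => /forallP pq.
pose a i := (p i + q i) / 2; pose de i := (q i - p i) / 2.
have de0 i : 0 <= de i by have := pq i; rewrite -ltNge /de; lra.
have E (Z : 'I_n -> Omega -> R) : (forall i, measurable_fun setT (Z i)) ->
    Ex P (fun w => \prod_i (`|Z i w - a i| < de i)%R%:R) =
    fine (P [set w | box p q [tuple Z k w | k < n]]).
  move=> mZ; rewrite -Ex_indic; last first.
    by rewrite preE -[X in measurable X]setTI; exact: measurable_tupleR.
  apply: eq_Rintegral => w _.
  have ballE i : (`|Z i w - a i| < de i) = (p i < Z i w < q i).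
    rewrite ltr_norml /a /de; apply/idP/idP => /andP[h1 h2]; apply/andP; split; lra.
  have [h|h] := boolP [forall i, p i < Z i w < q i].
    rewrite big1 => [|i _]; last by rewrite ballE (forallP h).
    by rewrite mem_set// => i; rewrite tnth_mktuple (forallP h).
  move: (h); rewrite negb_forall => /existsP[i /negbTE hi].
  rewrite (bigD1 i)//= ballE hi mul0r memNset// => /(_ i).
  by rewrite tnth_mktuple hi.
have [_ _] := same_expectation_ball a de0.
rewrite !E// => EXY.
have fin (Z : 'I_n -> Omega -> R) : (forall i, measurable_fun setT (Z i)) ->
    P [set w | box p q [tuple Z k w | k < n]] \is a fin_num.
  move=> mZ; apply: fin_num_measure.
  by rewrite preE -[X in measurable X]setTI; exact: measurable_tupleR.
by rewrite -[LHS]fineK ?fin// EXY fineK ?fin.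
Qed.

(** The characteristic function determines the law: the open boxes form a
    $\pi$-system that generates the product sigma-algebra. *)
Theorem equal_laws (B : set (n.-tuple R)) : measurable B ->
  P [set w | B [tuple X k w | k < n]] = P [set w | B [tuple Y k w | k < n]].
Proof.
move=> mB.
pose mu Z mZ := measure_function_pushforward__canonical__measure_function_Measure
  P (@measurable_tupleR Z mZ).
pose G := [set A | exists p q, A = box p q].
change (mu X mX B = mu Y mY B).
apply: (measure_unique G (fun k => box (fun=> - k%:R) (fun=> k%:R))) => //.
- rewrite eqEsubset; split.
    apply: smallest_sub; first exact: smallest_sigma_algebra.
    rewrite -bigcup_seq; apply: bigcup_sub => i _ A [C mC <-] /=.
    rewrite setTI.
    suff : (@ocitv R).-sigma.-measurable `<=`
        [set C | <<s G >> ((@tnth n R)^~ i @^-1` C)] by exact.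
    rewrite RGenOpens.measurableE; apply: smallest_sub.
      split => /=.
      + by rewrite preimage_set0; exact: sigma_algebra0.
      + by move=> D mD; rewrite setTD preimage_setC; exact: sigma_algebraC.
      + by move=> F mF; rewrite preimage_bigcup; exact: sigma_algebra_bigcup.
    move=> _ /= [x [y ->]].
    (* the other coordinates are unconstrained: exhaust them by ]-k, k[ *)
    pose F k := box (fun j => if j == i then x else - k%:R)
                    (fun j => if j == i then y else k%:R).
    rewrite (_ : _ @^-1` _ = \bigcup_k F k).
      apply: sigma_algebra_bigcup => k; apply: sub_sigma_algebra.
      by eexists; eexists; reflexivity.
    apply/seteqP; split => [t /=|t [k _ /(_ i)]]; rewrite /= ?in_itv/= ?eqxx//.
    move=> ti; pose k := Num.truncn (\sum_j `|tnth t j|).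
    exists k.+1 => // j; case: eqP => [->//|_].
    rewrite -ltr_norml (le_lt_trans _ (truncnS_gt _))//.
    by rewrite (bigD1 j)//= lerDl sumr_ge0.
  apply: smallest_sub; first exact: sigma_algebra_measurable.
  by move=> _ [p [q ->]]; exact: measurable_box.
- move=> _ _ [p [q ->]] [p' [q' ->]].
  exists (fun i => Num.max (p i) (p' i)), (fun i => Num.min (q i) (q' i)).
  apply/seteqP; split => [t [h h'] i|t h].
    by rewrite gt_max lt_min; have /andP[-> ->] := h i; have /andP[-> ->] := h' i.
  by split => i; have := h i; rewrite gt_max lt_min => /andP[/andP[? ?] /andP[? ?]];
    apply/andP.
- by move=> k; eexists; eexists; reflexivity.
- apply/seteqP; split => // t _; exists (Num.truncn (\sum_j `|tnth t j|)).+1 => // j.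
  rewrite -ltr_norml (le_lt_trans _ (truncnS_gt _))//.
  by rewrite (bigD1 j)//= lerDl sumr_ge0.
- by move=> _ [p [q ->]]; exact: same_box.
- move=> k; rewrite (le_lt_trans (probability_le1 P _)) ?ltry//.
  by rewrite -[X in measurable X]setTI; exact: measurable_tupleR.
Qed.

End equal_laws.

(** * Characteristic function of a sum of independent variables *)

Section independence.
Import HBNNSimple.
Context (R : realType) (dO : measure_display) (Omega : measurableType dO).
Variable P : probability Omega R.

Lemma Ex_indicM_ge0 (G : Omega -> R) (K : R) (X : Omega -> R) (f : R -> R) (L : R) :
  bdd_measurable G -> measurable_fun setT X -> measurable_fun setT f ->
  (forall B, measurable B ->
    Ex P (fun w => G w * \1_B (X w)) = K * Ex P (fun w => \1_B (X w))) ->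
  (forall x, 0 <= f x <= L) ->
  Ex P (fun w => G w * f (X w)) = K * Ex P (fun w => f (X w)).
Proof.
move=> bG mX mf GX f0L.
have mfE : measurable_fun setT (EFin \o f) by exact/measurable_EFinP.
have fE0 x : setT x -> (0%E <= (EFin \o f) x)%E.
  by move=> _; rewrite /= lee_fin; case/andP : (f0L x).
pose g := nnsfun_approx measurableT mfE.
have gf x : g m x @[m --> \oo] --> f x.
  by have /fine_cvgP[_] := cvg_nnsfun_approx measurableT mfE fE0 (I : setT x).
have gL m x : `|g m x| <= L.
  rewrite ger0_norm//; case/andP : (f0L x) => _; apply: le_trans.
  rewrite -(cvg_lim _ (gf x))//; apply: (@nondecreasing_cvgn_le _ (g ^~ x)).
    by move=> a b ab; exact/lefP/nd_nnsfun_approx.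
  exact: cvgP (gf x).
have bgX m : bdd_measurable (fun w => g m (X w)).
  split; last by exists L.
  by apply: measurableT_comp.
have mfX : measurable_fun setT (fun w => f (X w)) by exact: measurableT_comp.
have step m : Ex P (fun w => G w * g m (X w)) = K * Ex P (fun w => g m (X w)).
  pose s : seq R := finmap.enum_fset (fset_set (range (g m))).
  have gE x : g m x = \sum_(y <- s) y * \1_(g m @^-1` [set y]) x.
    by rewrite fimfunE fsbig_finite.
  have mA i : measurable (g m @^-1` [set i]) by exact: measurable_funPTI.
  have bI i : bdd_measurable (fun w => \1_(g m @^-1` [set i]) (X w) : R).
    split; first by apply: measurableT_comp => //; exact: measurable_indic.
    by exists 1 => w; rewrite indicE; case: (_ \in _); rewrite ?normr1 ?normr0.
  transitivity (Ex P (fun w => \sum_(i <- s)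
      i * (G w * \1_(g m @^-1` [set i]) (X w)))).
    apply: eq_Rintegral => w _; rewrite gE mulr_sumr.
    by apply: eq_bigr => i _; rewrite mulrCA.
  rewrite Ex_sum; last by move=> i; apply: bddZ; exact: bddM.
  transitivity (\sum_(i <- s) i * (K * Ex P (fun w => \1_(g m @^-1` [set i]) (X w)))).
    by apply: eq_bigr => i _; rewrite ExZ ?GX//; exact: bddM.
  transitivity (K * Ex P (fun w => \sum_(i <- s)
      i * \1_(g m @^-1` [set i]) (X w))); last first.
    by congr (_ * _); apply: eq_Rintegral => w _; rewrite gE.
  rewrite Ex_sum; last by move=> i; exact: bddZ.
  by rewrite mulr_sumr; apply: eq_bigr => i _; rewrite ExZ// mulrCA.
have [mG [LG GL]] := bG.
have c1 : Ex P (fun w => G w * g m (X w)) @[m --> \oo] -->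
    Ex P (fun w => G w * f (X w)).
  apply: (@bounded_convergence _ _ _ P (fun m w => G w * g m (X w)) _ (LG * L)).
  - by move=> m; apply: measurable_funM => //; case: (bgX m).
  - by move=> m w; rewrite normrM ler_pM.
  - exact: measurable_funM.
  - by move=> w; apply: cvgMr; exact: gf.
have c2 : Ex P (fun w => g m (X w)) @[m --> \oo] --> Ex P (fun w => f (X w)).
  apply: (@bounded_convergence _ _ _ P (fun m w => g m (X w)) _ L) => //.
  by move=> m; case: (bgX m).
have c3 : K * Ex P (fun w => g m (X w)) @[m --> \oo] -->
    K * Ex P (fun w => f (X w)) by exact: cvgMr.
rewrite -(cvg_lim _ c1)// -(cvg_lim _ c3)//.
by congr (lim (_ @ \oo)); apply/funext => m; exact: step.
Qed.

(** Both sides are integrals of $f(X)$, against the signed measures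
    $G\cdot P$ and $K P$, which agree on the sets $X^{-1}(B)$. *)
Lemma Ex_indicM (G : Omega -> R) (K : R) (X : Omega -> R) (f : R -> R) (L : R) :
  bdd_measurable G -> measurable_fun setT X -> measurable_fun setT f ->
  (forall B, measurable B ->
    Ex P (fun w => G w * \1_B (X w)) = K * Ex P (fun w => \1_B (X w))) ->
  (forall x, `|f x| <= L) ->
  Ex P (fun w => G w * f (X w)) = K * Ex P (fun w => f (X w)).
Proof.
move=> bG mX mf GX fL.
have bfX : bdd_measurable (fun w => f (X w)).
  by split; [exact: measurableT_comp|exists L].
have := @Ex_indicM_ge0 G K X (fun x => f x + L) (L + L) bG mX
  (measurable_funD mf (measurable_cst _)) GX.
have := @Ex_indicM_ge0 G K X (fun=> L) L bG mX (measurable_cst _) GX.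
have L0 : 0 <= L by exact: le_trans (normr_ge0 _) (fL 0).
move=> /(_ (fun=> introT andP (conj L0 (lexx _)))) EL.
have h x : 0 <= f x + L <= L + L.
  by have := fL x; rewrite ler_norml => /andP[? ?]; apply/andP; split; lra.
have bL : bdd_measurable (fun=> L : R) := bdd_cst Omega L.
move=> /(_ h); rewrite ExD// mulrDr -EL => E.
suff : Ex P (fun w => G w * (f (X w) + L)) =
    Ex P (fun w => G w * f (X w)) + Ex P (fun w => G w * L).
  by rewrite E => /addIr.
rewrite -ExD; [|exact: bddM|exact: bddM].
by apply: eq_Rintegral => w _; rewrite mulrDr.
Qed.

Variables (n : nat) (X : 'I_n -> {RV P >-> R}).
Hypothesis indX : mutually_independent X.

Let ind (B : 'I_n -> set R) (i : 'I_n) (w : Omega) : R := \1_(B i) (X i w).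

Let ind01 B i w : 0 <= ind B i w <= 1.
Proof. by rewrite /ind indicE; case: (_ \in _); rewrite ?lexx ?ler01. Qed.

Let bdd_ind B i : measurable (B i) -> bdd_measurable (ind B i).
Proof.
move=> mB; split; last first.
  by exists 1 => w; case/andP : (ind01 B i w) => h1 h2; rewrite ger0_norm.
by apply: measurableT_comp => //; exact: measurable_indic.
Qed.

Let bdd_prod_ind B (p : pred 'I_n) : (forall i, measurable (B i)) ->
  bdd_measurable (fun w => \prod_(i | p i) ind B i w).
Proof.
move=> mB; split.
  rewrite (_ : (fun _ => _) = fun w =>
      \prod_(i <- index_enum 'I_n) (if p i then ind B i w else 1)).
    apply: measurable_prod => i _; case: (p i) => //.
    by case: (@bdd_ind B i (mB i)).
  by apply/funext => w; rewrite big_mkcond.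
exists 1 => w; rewrite normr_prod; apply: prodr_ile1 => i _.
by case/andP : (ind01 B i w) => h1 h2; rewrite normr_ge0 ger0_norm.
Qed.

Let Ex_prod_ind B : (forall i, measurable (B i)) ->
  Ex P (fun w => \prod_i ind B i w) = \prod_i Ex P (ind B i).
Proof.
move=> mB.
have mXB i : measurable (X i @^-1` B i) by exact: measurable_funPTI.
have E w : \prod_i ind B i w = \1_(\bigcap_i (X i @^-1` B i)) w.
  rewrite indicE; have [h|h] := pselect (forall i, B i (X i w)).
    rewrite mem_set; last by move=> i _; exact: h.
    by rewrite big1// => i _; rewrite /ind indicE mem_set.
  rewrite memNset; last by move=> h'; apply: h => i; exact: h'.
  move/existsNP : h => [i Bi].
  by rewrite (bigD1 i)//= /ind indicE memNset// mul0r.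
under eq_Rintegral do rewrite E.
rewrite Ex_indic; last exact: fin_bigcap_measurable.
rewrite indX// (eq_bigr (fun i => (Ex P (ind B i))%:E)); last first.
  by move=> i _; rewrite (Ex_indic P (mXB i)) fineK// fin_num_measure.
by rewrite prodEFin.
Qed.

(** The joint law is only prescribed on products of events, so the exponentials
    replace the indicators of these events one variable at a time. *)
Lemma Ex_cos_sin_sum (c A B : 'I_n -> R) :
  (forall i, Ex P (fun w => cos (c i * X i w)) = expR (- A i) * cos (B i)) ->
  (forall i, Ex P (fun w => sin (c i * X i w)) = expR (- A i) * sin (B i)) ->
  Ex P (fun w => cos (\sum_i c i * X i w)) = expR (- \sum_i A i) * cos (\sum_i B i) /\
  Ex P (fun w => sin (\sum_i c i * X i w)) = expR (- \sum_i A i) * sin (\sum_i B i).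
Proof.
move=> Xcos Xsin.
pose S (j : nat) (F : 'I_n -> R) := \sum_(i < n | (i < j)%N) F i.
pose Q (j : nat) D w := \prod_(i < n | (j <= i)%N) ind D i w.
pose V j w := S j (fun i => c i * X i w).
have mV j : measurable_fun setT (V j).
  rewrite (_ : V j = fun w =>
      \sum_(i < n) (if (i < j)%N then c i * X i w else 0)).
    by apply: measurable_sum => i; case: (i < j)%N => //; exact: measurable_funM.
  by apply/funext => w; rewrite /V /S big_mkcond.
have claim j D : (j <= n)%N -> (forall i, measurable (D i)) ->
    Ex P (fun w => cos (V j w) * Q j D w) =
      expR (- S j A) * cos (S j B) * \prod_(i < n | (j <= i)%N) Ex P (ind D i) /\
    Ex P (fun w => sin (V j w) * Q j D w) =
      expR (- S j A) * sin (S j B) * \prod_(i < n | (j <= i)%N) Ex P (ind D i).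
  elim: j D => [|j IH] D.
    move=> _ mD; have S0 F : S 0%N F = 0 by rewrite /S big_pred0.
    rewrite !S0 oppr0 expR0 cos0 sin0 mulr0 mulr1 mul0r mul1r; split.
      rewrite -Ex_prod_ind//; apply: eq_Rintegral => w _.
      by rewrite [V _ _]S0 cos0 mul1r.
    transitivity (Ex P (fun=> 0 : R)); last by rewrite Rintegral_cst// mul0r.
    by apply: eq_Rintegral => w _; rewrite [V _ _]S0 sin0 mul0r.
  move=> jn mD; pose o := Ordinal jn.
  have SS F : S j.+1 F = S j F + F o.
    rewrite /S (bigD1 o) ?ltnSn//= addrC; congr (_ + _); apply: eq_bigl => i.
    by rewrite ltnS -val_eqE/= andbC -ltn_neqAle.
  have QQ (F : 'I_n -> R) :
      \prod_(i < n | (j <= i)%N) F i = F o * \prod_(i < n | (j.+1 <= i)%N) F i.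
    rewrite (bigD1 o)//=; congr (_ * _); apply: eq_bigl => i.
    by rewrite -val_eqE/= eq_sym andbC -ltn_neqAle.
  pose upd E i := if i == o then E else D i.
  have mupd E : measurable E -> forall i, measurable (upd E i).
    by move=> mE i; rewrite /upd; case: ifP.
  have updo E : ind (upd E) o = fun w => \1_E (X o w).
    by rewrite /ind /upd eqxx.
  have updQ E (I : ('I_n -> set R) -> 'I_n -> R) :
      (forall i, i != o -> I (upd E) i = I D i) ->
      \prod_(i < n | (j.+1 <= i)%N) I (upd E) i = \prod_(i < n | (j.+1 <= i)%N) I D i.
    move=> IE; apply: eq_bigr => i ji; apply: IE.
    by apply: contraTneq ji => ->; rewrite /= ltnn.
  have updw E i w : i != o -> ind (upd E) i w = ind D i w.
    by rewrite /ind /upd => /negbTE ->.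
  pose K := \prod_(i < n | (j.+1 <= i)%N) Ex P (ind D i).
  have bQ : bdd_measurable (Q j.+1 D) by exact: bdd_prod_ind.
  have bC : bdd_measurable (fun w => cos (V j w) * Q j.+1 D w).
    by apply: bddM => //; exact: bdd_cos.
  have bS : bdd_measurable (fun w => sin (V j w) * Q j.+1 D w).
    by apply: bddM => //; exact: bdd_sin.
  have indC E : measurable E ->
      Ex P (fun w => cos (V j w) * Q j.+1 D w * \1_E (X o w)) =
        expR (- S j A) * cos (S j B) * K * Ex P (fun w => \1_E (X o w)) /\
      Ex P (fun w => sin (V j w) * Q j.+1 D w * \1_E (X o w)) =
        expR (- S j A) * sin (S j B) * K * Ex P (fun w => \1_E (X o w)).
    move=> mE; have [] := IH (upd E) (ltnW jn) (mupd E mE).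
    rewrite QQ updo (updQ E (fun D i => Ex P (ind D i))); last first.
      by move=> i io; apply: eq_Rintegral => w _; exact: updw.
    rewrite -/K => EC ES; split.
      rewrite -mulrA [K * _]mulrC -EC; apply: eq_Rintegral => w _.
      rewrite /Q QQ updo (updQ E (fun D i => ind D i w)); last first.
        by move=> i; exact: updw.
      by rewrite mulrA mulrAC.
    rewrite -mulrA [K * _]mulrC -ES; apply: eq_Rintegral => w _.
    rewrite /Q QQ updo (updQ E (fun D i => ind D i w)); last first.
      by move=> i; exact: updw.
    by rewrite mulrA mulrAC.
  have mcos : measurable_fun setT (fun x : R => cos (c o * x)).
    by apply: measurableT_comp (@measurable_cos R) _; exact: measurable_funM.
  have msin : measurable_fun setT (fun x : R => sin (c o * x)).
    by apply: measurableT_comp (@measurable_sin R) _; exact: measurable_funM.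
  have mXo : measurable_fun setT (X o) by [].
  have indC1 E mE := proj1 (indC E mE).
  have indC2 E mE := proj2 (indC E mE).
  have CC := Ex_indicM bC mXo mcos indC1 (fun x => norm_cos_le1 (c o * x)).
  have CS := Ex_indicM bC mXo msin indC1 (fun x => norm_sin_le1 (c o * x)).
  have SC := Ex_indicM bS mXo mcos indC2 (fun x => norm_cos_le1 (c o * x)).
  have SN := Ex_indicM bS mXo msin indC2 (fun x => norm_sin_le1 (c o * x)).
  have bc : bdd_measurable (fun w => cos (c o * X o w)).
    by apply: bdd_cos; exact: measurable_funM.
  have bs : bdd_measurable (fun w => sin (c o * X o w)).
    by apply: bdd_sin; exact: measurable_funM.
  rewrite -/K !SS opprD expRD cosD sinD; split.
    transitivity (Ex P (fun w => cos (V j w) * Q j.+1 D w * cos (c o * X o w)) -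
                  Ex P (fun w => sin (V j w) * Q j.+1 D w * sin (c o * X o w))).
      rewrite -ExB; [|exact: bddM|exact: bddM].
      by apply: eq_Rintegral => w _; rewrite [V j.+1 w]SS cosD; ring.
    by rewrite CC SN Xcos Xsin; ring.
  transitivity (Ex P (fun w => sin (V j w) * Q j.+1 D w * cos (c o * X o w)) +
                Ex P (fun w => cos (V j w) * Q j.+1 D w * sin (c o * X o w))).
    rewrite -ExD; [|exact: bddM|exact: bddM].
    by apply: eq_Rintegral => w _; rewrite [V j.+1 w]SS sinD; ring.
  by rewrite SC CS Xcos Xsin; ring.
have [] := claim n (fun=> setT) (leqnn n) (fun=> measurableT).
have SE F : S n F = \sum_i F i by apply: eq_bigl => i; rewrite ltn_ord.
have Q1 (F : 'I_n -> R) : \prod_(i < n | (n <= i)%N) F i = 1.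
  by apply: big_pred0 => i; rewrite leqNgt ltn_ord.
rewrite Q1 !mulr1 !SE => <- <-; split; apply: eq_Rintegral => w _.
  by rewrite /Q Q1 mulr1 [V n w]SE.
by rewrite /Q Q1 mulr1 [V n w]SE.
Qed.

End independence.

(** * Stable integrals of simple functions *)

Lemma powR_max_add (R : realType) (c a : R) : a != 0 ->
  Num.max c 0 `^ a + Num.max (- c) 0 `^ a = `|c| `^ a.
Proof.
move=> a0; have [c0|c0|->] := ltrgt0P c.
- by rewrite [X in _ + X `^ _]max_r ?oppr_le0 ?ltW// powR0// addr0.
- by rewrite [X in _ + X `^ _]max_l ?oppr_ge0 ?ltW// powR0// add0r.
- by rewrite oppr0 maxxx powR0// addr0.
Qed.

Lemma powR_max_sub (R : realType) (c a : R) : a != 0 ->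
  Num.max c 0 `^ a - Num.max (- c) 0 `^ a = `|c| `^ a * Num.sg c.
Proof.
move=> a0; have [c0|c0|->] := ltrgt0P c.
- by rewrite [X in _ - X `^ _]max_r ?oppr_le0 ?ltW// powR0// subr0 gtr0_sg// mulr1.
- by rewrite [X in _ - X `^ _]max_l ?oppr_ge0 ?ltW// powR0// sub0r ltr0_sg// mulrN1.
- by rewrite oppr0 maxxx powR0// subr0 mul0r.
Qed.

Section stable_measure.
Import HBSimple.
Context (R : realType) (dO : measure_display) (Omega : measurableType dO).
Variable P : probability Omega R.
Context (dE : measure_display) (E : measurableType dE).
Variables (m : {measure set E -> \bar R}) (alpha b : R).
Hypothesis alpha0 : 0 < alpha.
Variable M : set E -> {RV P >-> R}.
Hypothesis hM : stable_random_measure m alpha b M.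
Local Notation fin := (finite_measure_sets m).

Lemma fin_set0 : fin set0.
Proof. by split => //; rewrite measure0. Qed.

(** The series of the values at the empty set converges only if they vanish. *)
Lemma srm_set0 : {ae P, forall w, M set0 w = 0}.
Proof.
have := srm_sigma_additive hM (A := fun=> set0) (fun=> fin_set0)
  (@trivIset_set0 _ _ setT).
rewrite (_ : \bigcup_i set0 = set0); last by rewrite bigcup0.
move=> /(_ fin_set0); apply: filterS => w h.
have h1 : \sum_(0 <= i < n.+1) M set0 w @[n --> \oo] --> M set0 w.
  by have := h; rewrite -(cvg_shiftS (fun n => \sum_(0 <= i < n) M set0 w)).
have : \sum_(0 <= i < n.+1) M set0 w - \sum_(0 <= i < n) M set0 w @[n --> \oo]
    --> M set0 w - M set0 w by exact: cvgB.
under eq_fun do rewrite big_nat_recr//= addrAC subrr add0r.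
by rewrite subrr => /cvg_lim <-//; rewrite lim_cst.
Qed.

Lemma srm_finite_additive (N : nat) (F : 'I_N -> set E) (p : pred 'I_N)
    (B : set E) : (forall j, fin (F j)) -> trivIset setT F -> fin B ->
  B = \bigcup_(j in [set j | p j]) F j ->
  {ae P, forall w, M B w = \sum_(j | p j) M (F j) w}.
Proof.
move=> finF tF finB BF.
pose A (k : nat) :=
  if insub k is Some j then (if p j then F j else set0) else set0.
have AE (j : 'I_N) : A j = if p j then F j else set0 by rewrite /A valK.
have A0 k : (N <= k)%N -> A k = set0 by move=> Nk; rewrite /A insubN// -leqNgt.
have finA k : fin (A k).
  rewrite /A; case: insub => [j|]; last exact: fin_set0.
  by case: (p j); [exact: finF|exact: fin_set0].
have tA : trivIset setT A.
  move=> k k' _ _ [x []]; rewrite /A.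
  case: insubP => [j _ <-|//]; case: (p j) => //.
  case: insubP => [j' _ <-|//]; case: (p j') => // Fj Fj'.
  by congr nat_of_ord; apply: tF => //; exists x.
have UA : \bigcup_k A k = B.
  rewrite BF; apply/seteqP; split => [x [k _]|x [j /= pj Fj]].
    by rewrite /A; case: insub => [j|//]; case: ifP => // pj Fj; exists j.
  by exists j => //; rewrite AE pj.
have := srm_sigma_additive hM finA tA.
rewrite UA => /(_ finB) h; move: srm_set0 h; apply: filterS2 => w M0 h.
have lim_sum : \sum_(0 <= i < n) M (A i) w @[n --> \oo] --> \sum_(j | p j) M (F j) w.
  apply: cvg_near_cst; exists N => // n /= Nn.
  rewrite (big_cat_nat _ (n := N))//=.
  have -> : \sum_(N <= k < n) M (A k) w = 0.
    rewrite big_nat_cond big1// => k.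
    by rewrite andbT => /andP[Nk _]; rewrite A0.
  rewrite addr0.
  rewrite big_mkord [RHS]big_mkcond/=; apply: eq_bigr => j _.
  by rewrite AE; case: (p j).
by rewrite -(cvg_lim _ h)// (cvg_lim _ lim_sum).
Qed.

Lemma srm_charfun (A : set E) (c : R) : fin A ->
  Ex P (fun w => cos (c * M A w)) = expR (- (fine (m A) * `|c| `^ alpha)) *
    cos (b * tan (pi * alpha / 2) * (fine (m A) * `|c| `^ alpha * Num.sg c)) /\
  Ex P (fun w => sin (c * M A w)) = expR (- (fine (m A) * `|c| `^ alpha)) *
    sin (b * tan (pi * alpha / 2) * (fine (m A) * `|c| `^ alpha * Num.sg c)).
Proof.
move=> finA; have := srm_law hM finA c.
rewrite /charfun /cexp -powRrM mulVf ?gt_eqF// powRr1; last exact: fine_ge0.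
rewrite unlock => -[eC eS]; rewrite /Rintegral eC eS /=.
set t := tan _; set s := fine (m A) * _.
have -> : s * 1 - 0 * - (b * Num.sg c * t) = s by ring.
have -> // : - (s * - (b * Num.sg c * t) + 0 * 1) = b * t * (s * Num.sg c) by ring.
Qed.

Section level_sets.
Variables (n : nat) (g : 'I_n -> {sfun E >-> R}).
Hypothesis gL : forall k, (g k : E -> R) \in Lfun m alpha%:E.

Lemma fin_sfun_level k (c : R) : c != 0 -> fin (g k @^-1` [set c]).
Proof.
move=> c0; have mg : measurable (g k @^-1` [set c]) by exact: measurable_funPTI.
split => //.
have := gL k; rewrite inE => /andP[_]; rewrite inE /= /finite_norm => gfin.
have := poweR_lty alpha gfin; rewrite powR_Lnorm ?gt_eqF// => ifin.
have ca : 0 < `|c| `^ alpha by rewrite powR_gt0 ?normr_gt0.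
have le : ((`|c| `^ alpha)%:E * m (g k @^-1` [set c]) <=
    \int[m]_x (`|(EFin \o g k) x| `^ alpha)%E)%E.
  have -> : ((`|c| `^ alpha)%:E * m (g k @^-1` [set c]) =
      \int[m]_(x in g k @^-1` [set c]) (`|c| `^ alpha)%:E)%E.
    by rewrite integral_cst.
  apply: (@le_trans _ _ (\int[m]_(x in g k @^-1` [set c])
      `|(EFin \o g k) x| `^ alpha)%E).
    rewrite le_eqVlt; apply/orP; left; apply/eqP; apply: eq_integral => x.
    by rewrite inE /= => ->.
  apply: ge0_subset_integral => //.
  - apply/measurable_EFinP.
    apply: (@measurableT_comp _ _ _ _ _ _ (fun x : R => x `^ alpha)) => //.
    exact: measurableT_comp.
  - by move=> x _; rewrite /= lee_fin powR_ge0.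
rewrite ltNge leye_eq; apply/negP => /eqP moo.
by move: (le_lt_trans le ifin); rewrite moo gt0_muley ?lte_fin// ltxx.
Qed.

(** Indexing the joint level sets by functions into a finite list of values
    makes them a finite type.  The random measure is controlled only on sets of
    finite measure, which the joint level set of the value 0 may fail to be; it
    does not contribute to the integrals and is left out. *)
Let vals : seq R :=
  undup (flatten [seq finmap.enum_fset (fset_set (range (g k))) | k <- enum 'I_n]).
Let cell (h : {ffun 'I_n -> 'I_(size vals)}) : set E :=
  [set x | forall k, g k x = vals`_(h k)].
Let live : pred {ffun 'I_n -> 'I_(size vals)} :=
  fun h => `[< cell h !=set0 >] && [exists k, vals`_(h k) != 0].

Let mem_vals k x : g k x \in vals.
Proof.
rewrite mem_undup; apply/flattenP.
exists (finmap.enum_fset (fset_set (range (g k)))).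
  by apply/mapP; exists k => //; rewrite mem_enum.
by rewrite in_fset_set// inE; exists x.
Qed.

Lemma level_sets : exists (N : nat) (F : 'I_N -> set E) (v : 'I_N -> 'I_n -> R),
  [/\ forall j, fin (F j), trivIset setT F,
      forall j, F j !=set0,
      forall j x, F j x -> forall k, g k x = v j k &
      forall x, (exists k, g k x != 0) -> exists j, F j x].
Proof.
pose T := {h | live h}.
pose hh (j : 'I_#|{: T}|) : {ffun 'I_n -> 'I_(size vals)} := val (enum_val j : T).
exists #|{: T}|, (fun j => cell (hh j)), (fun j k => vals`_(hh j k)).
have cell_inj h h' x : cell h x -> cell h' x -> h = h'.
  move=> hx h'x; apply/ffunP => k; apply/val_inj/eqP.
  have := nth_uniq 0 (ltn_ord (h k)) (ltn_ord (h' k)) (undup_uniq _).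
  by rewrite -/vals -hx -h'x eqxx => /esym.
have liveT j : live (hh j) by exact: (valP (enum_val j : T)).
split.
- move=> j; case/andP : (liveT j) => _ /existsP[k vk].
  have mcell h : measurable (cell h).
    rewrite (_ : cell h = \bigcap_(i in [set: 'I_n]) (g i @^-1` [set vals`_(h i)])).
      by apply: fin_bigcap_measurable => // i _; exact: measurable_funPTI.
    by apply/seteqP; split => x /= hx i => [_|]; exact: hx.
  have [mg goo] := fin_sfun_level k vk; split => //.
  apply: le_lt_trans goo; apply: le_measure; rewrite ?inE//.
  by move=> x; exact.
- move=> i j _ _ [x [hi hj]]; apply: enum_val_inj; apply: val_inj.
  exact: cell_inj hi hj.
- by move=> j; case/andP : (liveT j) => /asboolP.
- by move=> j x; exact.
- move=> x [k gk].
  have ix i : (index (g i x) vals < size vals)%N by rewrite index_mem mem_vals.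
  pose h : {ffun 'I_n -> 'I_(size vals)} := [ffun i => Ordinal (ix i)].
  have hx : cell h x by move=> i; rewrite ffunE /= nth_index ?mem_vals.
  have lh : live h.
    apply/andP; split; first by apply/asboolP; exists x.
    by apply/existsP; exists k; rewrite -hx.
  by exists (enum_rank (exist _ h lh : T)); rewrite /hh enum_rankK.
Qed.

End level_sets.

(** The characteristic function at 1 of a stable variable, in real and imaginary
    parts: if $I$ and $J$ are the integrals of $(f^+)^\alpha$ and $(f^-)^\alpha$,
    then $I+J$ and $I-J$ are those of $|f|^\alpha$ and
    $\varepsilon(f)|f|^\alpha$. *)
Definition stable_cf (I J kappa : R) (S : Omega -> R) :=
  Ex P (fun w => cos (S w)) = expR (- (I + J)) * cos (kappa * (I - J)) /\
  Ex P (fun w => sin (S w)) = expR (- (I + J)) * sin (kappa * (I - J)).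

(** Taken at $f$ and at $-f$, it replaces the pair of functionals
    $\int|f|^\alpha$ and $\int\varepsilon(f)|f|^\alpha$.  Unlike the second of
    these, it is the power of a norm, that of $f^+$, hence visibly continuous on
    $L^\alpha$. *)
Definition pos_power (f : E -> R) : \bar R :=
  (\int[m]_x ((Num.max (f x) 0) `^ alpha)%:E)%E.

Lemma ae_eq_sum (T : eqType) (s : seq T) (f h : T -> Omega -> R) :
  (forall c, {ae P, forall w, f c w = h c w}) ->
  {ae P, forall w, \sum_(c <- s) f c w = \sum_(c <- s) h c w}.
Proof.
move=> fh; elim: s => [|c s IH]; first by apply: aeW => w; rewrite !big_nil.
by move: (fh c) IH; apply: filterS2 => w e1 e2; rewrite !big_cons e1 e2.
Qed.

Lemma measurable_simple_stable_integral (g : {sfun E >-> R}) :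
  measurable_fun setT (simple_stable_integral M g).
Proof.
rewrite (_ : simple_stable_integral M g = fun w =>
    \sum_(c <- finmap.enum_fset (fset_set (range g))) c * M (g @^-1` [set c]) w).
  by apply: measurable_sum => c; exact: measurable_funM.
by apply/funext => w; rewrite /simple_stable_integral fsbig_finite.
Qed.

Section simple_functions.
Variables (n : nat) (g : 'I_n -> {sfun E >-> R}).
Hypothesis gL : forall k, (g k : E -> R) \in Lfun m alpha%:E.
Variables (N : nat) (F : 'I_N -> set E) (v : 'I_N -> 'I_n -> R).
Hypotheses (finF : forall j, fin (F j)) (tF : trivIset setT F)
  (F0 : forall j, F j !=set0)
  (gF : forall j x, F j x -> forall k, g k x = v j k)
  (coverF : forall x, (exists k, g k x != 0) -> exists j, F j x).

Lemma simple_stable_integral_cells k :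
  {ae P, forall w, simple_stable_integral M (g k) w = \sum_j v j k * M (F j) w}.
Proof.
pose s : seq R := finmap.enum_fset (fset_set (range (g k))).
have : {ae P, forall w, \sum_(c <- s) c * M (g k @^-1` [set c]) w =
    \sum_(c <- s) c * \sum_(j | v j k == c) M (F j) w}.
  apply: ae_eq_sum => c; have [->|c0] := eqVneq c 0.
    by apply: aeW => w; rewrite !mul0r.
  have finc := fin_sfun_level gL k c0.
  have cE : g k @^-1` [set c] = \bigcup_(j in [set j | v j k == c]) F j.
    apply/seteqP; split => [x /= gx|x [j /= /eqP <- /gF ->//]].
    have [|j Fj] := coverF (x := x); first by exists k; rewrite gx.
    by exists j => //=; rewrite -(gF Fj) gx.
  by apply: filterS (srm_finite_additive finF tF finc cE) => w ->.
apply: filterS => w.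
rewrite /simple_stable_integral fsbig_finite//= => ->.
under eq_bigr do rewrite mulr_sumr big_mkcond/=.
rewrite exchange_big/=; apply: eq_bigr => j _.
have [x Fx] := F0 j.
have sv : v j k \in s by rewrite in_fset_set// inE; exists x => //; exact: gF.
rewrite (bigD1_seq (v j k))//= ?eqxx ?finmap.fset_uniq// big1 ?addr0// => c.
by rewrite eq_sym => /negbTE ->.
Qed.

Lemma pos_power_cells (phi : ('I_n -> R) -> R) : phi (fun=> 0) = 0 ->
  pos_power (fun x => phi (g ^~ x)) =
  (\sum_j ((Num.max (phi (v j)) 0) `^ alpha * fine (m (F j))))%:E.
Proof.
move=> phi0; pose c j := (Num.max (phi (v j)) 0) `^ alpha.
have hE x : (Num.max (phi (g ^~ x)) 0) `^ alpha = \sum_j c j * \1_(F j) x.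
  have [[j Fj]|noF] := pselect (exists j, F j x).
    rewrite (bigD1 j)//= indicE mem_set// mulr1 big1 => [|i ij].
      rewrite addr0 /c; congr (Num.max (phi _) _ `^ _).
      by apply/funext => k; exact: gF.
    rewrite indicE memNset ?mulr0// => Fi; move/eqP : ij; apply.
    by apply: tF => //; exists x.
  rewrite big1 => [|j _]; last first.
    by rewrite indicE memNset ?mulr0// => Fj; apply: noF; exists j.
  rewrite (_ : g ^~ x = fun=> 0) ?phi0 ?maxxx ?powR0 ?gt_eqF//.
  apply/funext => k; apply/eqP/negPn/negP => gk.
  by apply: noF; apply: coverF; exists k.
rewrite /pos_power.
under eq_integral do rewrite hE -sumEFin.
rewrite ge0_integral_sum//; last 2 first.
- move=> j; apply/measurable_EFinP; apply: measurable_funM => //.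
  exact: measurable_indic (finF j).1.
- by move=> j x _; rewrite lee_fin mulr_ge0// powR_ge0.
rewrite -sumEFin; apply: eq_bigr => j _.
under eq_integral do rewrite EFinM.
have [mF Foo] := finF j.
rewrite ge0_integralZl_EFin ?powR_ge0//.
  by rewrite integral_indic// setIT EFinM fineK// ge0_fin_numE.
by apply/measurable_EFinP; exact: measurable_indic.
Qed.

Let lin (u : 'I_n -> R) (th : 'I_n -> R) := \sum_k th k * u k.

(** Over common cells, the linear combination of the integrals is a linear
    combination of independent stable variables with the coefficients
    $\sum_k\theta_k v_{jk}$, so the exponents add up. *)
Lemma simple_stable_cf_cells (th : 'I_n -> R) :
  stable_cf (fine (pos_power (fun x => \sum_k th k * g k x)))
    (fine (pos_power (fun x => - \sum_k th k * g k x)))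
    (b * tan (pi * alpha / 2))
    (fun w => \sum_k th k * simple_stable_integral M (g k) w).
Proof.
pose c j := lin (v j) th.
have lin0 : lin (fun=> 0) th = 0 by rewrite /lin big1// => k _; rewrite mulr0.
rewrite (pos_power_cells (phi := fun u => lin u th) lin0).
rewrite (pos_power_cells (phi := fun u => - lin u th)); last by rewrite lin0 oppr0.
have aeS : {ae P, forall w, \sum_k th k * simple_stable_integral M (g k) w =
    \sum_j c j * M (F j) w}.
  have : {ae P, forall w, \sum_k th k * simple_stable_integral M (g k) w =
      \sum_k th k * \sum_j v j k * M (F j) w}.
    apply: ae_eq_sum => k.
    by apply: filterS (simple_stable_integral_cells k) => w ->.
  apply: filterS => w ->; under eq_bigr do rewrite mulr_sumr.
  rewrite exchange_big/=; apply: eq_bigr => j _.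
  by rewrite /c /lin mulr_suml; apply: eq_bigr => k _; rewrite mulrA.
have mS : measurable_fun setT
    (fun w => \sum_k th k * simple_stable_integral M (g k) w).
  apply: measurable_sum => k; apply: measurable_funM => //.
  exact: measurable_simple_stable_integral.
have mS' : measurable_fun setT (fun w => \sum_j c j * M (F j) w).
  by apply: measurable_sum => j; exact: measurable_funM.
pose kap := b * tan (pi * alpha / 2).
pose A j := fine (m (F j)) * `|c j| `^ alpha.
pose B j := kap * (A j * Num.sg (c j)).
have [EC ES] := Ex_cos_sin_sum (srm_independently_scattered hM finF tF)
  (c := c) (A := A) (B := B) (fun j => proj1 (srm_charfun (c j) (finF j)))
  (fun j => proj2 (srm_charfun (c j) (finF j))).
set I := fine _%:E; set J := fine _%:E.
have a0 : alpha != 0 by rewrite gt_eqF.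
have IJ : I + J = \sum_j A j.
  rewrite /I /J /= -big_split/=; apply: eq_bigr => j _.
  by rewrite -mulrDl powR_max_add// mulrC.
have IJB : kap * (I - J) = \sum_j B j.
  rewrite /I /J /= -mulr_sumr; congr (_ * _).
  rewrite -sumrB; apply: eq_bigr => j _.
  by rewrite -mulrBl powR_max_sub// mulrC mulrA.
rewrite /stable_cf IJ IJB -EC -ES; split; apply: ae_eq_Ex.
- exact: bdd_measurable_fun (bdd_cos mS).
- exact: bdd_measurable_fun (bdd_cos mS').
- by apply: filterS aeS => w ->.
- exact: bdd_measurable_fun (bdd_sin mS).
- exact: bdd_measurable_fun (bdd_sin mS').
- by apply: filterS aeS => w ->.
Qed.

End simple_functions.

Theorem simple_stable_cf (n : nat) (g : 'I_n -> {sfun E >-> R}) (th : 'I_n -> R) :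
  (forall k, (g k : E -> R) \in Lfun m alpha%:E) ->
  stable_cf (fine (pos_power (fun x => \sum_k th k * g k x)))
    (fine (pos_power (fun x => - \sum_k th k * g k x)))
    (b * tan (pi * alpha / 2))
    (fun w => \sum_k th k * simple_stable_integral M (g k) w).
Proof.
move=> gL; have [N [F [v [finF tF F0 gF coverF]]]] := level_sets gL.
exact (simple_stable_cf_cells gL finF tF F0 gF coverF th).
Qed.

End stable_measure.

(** * Stable integrals as limits *)

Section Lnorm_limits.
Context (R : realType) (dE : measure_display) (E : measurableType dE).
Variables (m : {measure set E -> \bar R}) (a : R).
Hypothesis a1 : 1 <= a.
Implicit Types u v : E -> R.
Local Notation N u := ('N[m]_(a%:E)[EFin \o u%R])%E.
Local Notation pos u := (fun x : E => Num.max (u x) 0).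

Let a0 : 0 < a. Proof. exact: lt_le_trans a1. Qed.

Lemma Lfun_measurable u : u \in Lfun m a%:E -> measurable_fun setT u.
Proof. by rewrite inE => /andP[]; rewrite inE. Qed.

Lemma Lfun_lty u : u \in Lfun m a%:E -> (N u < +oo)%E.
Proof. by rewrite inE => /andP[_]; rewrite inE. Qed.

Lemma le_Lnorm u v : measurable_fun setT u -> measurable_fun setT v ->
  (forall x, `|u x| <= `|v x|) -> (N u <= N v)%E.
Proof.
move=> mu mv uv.
have mp (w : E -> R) : measurable_fun setT w ->
    measurable_fun setT (fun x : E => `|(EFin \o w) x| `^ a)%E.
  move=> mw; apply/measurable_EFinP.
  apply: (@measurableT_comp _ _ _ _ _ _ (fun x : R => x `^ a)) => //.
  exact: measurableT_comp.
rewrite unlock; apply: gt0_ler_poweR; first by rewrite invr_ge0 ltW.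
- by rewrite in_itv/= leey integral_ge0.
- by rewrite in_itv/= leey integral_ge0.
apply: ge0_le_integral => //; first by move=> x _; exact: poweR_ge0.
- exact: mp.
- exact: mp.
- move=> x _; rewrite /= lee_fin; apply: ge0_ler_powR; rewrite ?nnegrE//.
  exact: ltW.
Qed.

Lemma measurable_pos u : measurable_fun setT u -> measurable_fun setT (pos u).
Proof. by move=> mu; exact: measurable_maxr. Qed.

(** The map $u\mapsto u^+$ is 1-Lipschitz, pointwise and therefore in norm. *)
Lemma Lnorm_pos_le u v : measurable_fun setT u -> measurable_fun setT v ->
  (N (pos u) <= N (pos v) + N (fun x => u x - v x))%E.
Proof.
move=> mu mv; have mpu := measurable_pos mu; have mpv := measurable_pos mv.
have mB : measurable_fun setT (fun x => pos u x - pos v x) by exact: measurable_funB.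
have mB' : measurable_fun setT (fun x => u x - v x) by exact: measurable_funB.
apply: (@le_trans _ _ (N (pos v) + N (fun x => pos u x - pos v x)))%E.
  apply: le_trans (minkowski_EFin m mpv mB a1).
  apply: le_Lnorm => //; first exact: measurable_funD.
  by move=> x /=; rewrite subrKC.
rewrite leeD2l//; apply: le_Lnorm => // x /=.
have [hu|hu] := leP (u x) 0; have [hv|hv] := leP (v x) 0;
  rewrite ?subr0 ?sub0r ?subrr ?normr0//.
- by rewrite normrN gtr0_norm// ler0_norm; lra.
- by rewrite gtr0_norm// ger0_norm; lra.
Qed.

Lemma Lfun_pos u : u \in Lfun m a%:E -> pos u \in Lfun m a%:E.
Proof.
move=> lu; have mu := Lfun_measurable lu; rewrite inE; apply/andP; split.
  by rewrite inE; exact: measurable_pos.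
rewrite inE /finite_norm; apply: le_lt_trans (Lfun_lty lu).
apply: le_Lnorm => //; first exact: measurable_pos.
by move=> x; have [h|h] := leP (u x) 0; rewrite ?normr0.
Qed.

Lemma LfunD u v : u \in Lfun m a%:E -> v \in Lfun m a%:E ->
  (fun x => u x + v x) \in Lfun m a%:E.
Proof. by move=> lu lv; exact: (Lfun_addr_closed m (a1 : (1 <= a%:E)%E)).2. Qed.

Lemma LfunZ c u : u \in Lfun m a%:E -> (fun x => c * u x) \in Lfun m a%:E.
Proof.
move=> lu; rewrite (_ : (fun x => _) = c \o* u); first exact: Lfun_scale.
by apply/funext => x /=; rewrite mulrC.
Qed.

Lemma LfunN u : u \in Lfun m a%:E -> (fun x => - u x) \in Lfun m a%:E.
Proof.
move=> lu; rewrite (_ : (fun x => _) = fun x => (-1) * u x); first exact: LfunZ.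
by apply/funext => x; rewrite mulN1r.
Qed.

Lemma LfunB u v : u \in Lfun m a%:E -> v \in Lfun m a%:E ->
  (fun x => u x - v x) \in Lfun m a%:E.
Proof. by move=> lu lv; apply: LfunD => //; exact: LfunN. Qed.

Lemma Lfun_sum I (s : seq I) (u : I -> E -> R) :
  (forall k, u k \in Lfun m a%:E) -> (fun x => \sum_(k <- s) u k x) \in Lfun m a%:E.
Proof.
move=> lu; elim: s => [|k s IH].
  rewrite (_ : (fun _ => _) = fun=> 0); last by apply/funext => x; rewrite big_nil.
  exact: (Lfun_addr_closed m (a1 : (1 <= a%:E)%E)).1.
rewrite (_ : (fun _ => _) = fun x => u k x + \sum_(k <- s) u k x); first exact: LfunD.
by apply/funext => x; rewrite big_cons.
Qed.

Lemma Lnorm_scale c u : u \in Lfun m a%:E ->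
  (N (fun x => c * u x)%R = `|c|%:E * N u)%E.
Proof. by move=> lu; exact: (LnormZ (Lfun_Sub (a1 : (1 <= a%:E)%E) lu) c). Qed.

Lemma Lnorm_sum_cvg0 I (s : seq I) (th : I -> R) (u : I -> (E -> R)^nat) :
  (forall k t, u k t \in Lfun m a%:E) ->
  (forall k, N (u k t) @[t --> \oo] --> 0%E) ->
  N (fun x => \sum_(k <- s) th k * u k t x)%R @[t --> \oo] --> 0%E.
Proof.
move=> lu u0; elim: s => [|k s IH].
  rewrite (_ : (fun _ => _) = fun=> 0%E); first exact: cvg_cst.
  apply/funext => t; rewrite -(Lnorm0 m (p := a%:E)); last by rewrite gt_eqF// lte_fin.
  by apply: eq_Lnorm => x /=; rewrite big_nil.
apply: (@squeeze_cvge _ _ _ _ (fun=> 0%E) _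
  (fun t => `|th k|%:E * N (u k t) + N (fun x => \sum_(k <- s) th k * u k t x)%R)%E).
- apply: nearW => t; rewrite Lnorm_ge0/= -Lnorm_scale//.
  have l1 : (fun x => th k * u k t x) \in Lfun m a%:E by exact: LfunZ.
  have l2 : (fun x => \sum_(k <- s) th k * u k t x) \in Lfun m a%:E.
    by apply: (@Lfun_sum _ s (fun k x => th k * u k t x)) => i; exact: LfunZ.
  apply: le_trans (minkowski_EFin m (Lfun_measurable l1) (Lfun_measurable l2) a1).
  by rewrite le_eqVlt; apply/orP; left; apply/eqP/eq_Lnorm => x /=; rewrite big_cons.
- exact: cvg_cst.
- rewrite -[X in _ --> X]adde0; apply: cvgeD => //.
  by rewrite -(mule0 `|th k|%:E); apply: cvgeZl.
Qed.

Lemma cvg_powR (u : R^nat) (l : R) : (forall t, 0 <= u t) ->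
  u t @[t --> \oo] --> l -> u t `^ a @[t --> \oo] --> l `^ a.
Proof.
move=> u0 ul; have l0 : 0 <= l.
  by rewrite -(cvg_lim _ ul)//; apply: limr_ge; [exact: cvgP ul|exact: nearW].
have [lz|lnz] := eqVneq l 0.
  rewrite lz powR0 ?gt_eqF//; apply/cvgrPdist_lt => e e0.
  have ea : 0 < e `^ a^-1 by exact: powR_gt0.
  move/cvgrPdist_lt : ul => /(_ _ ea); apply: filterS => t.
  rewrite lz !sub0r !normrN ger0_norm// ger0_norm ?powR_ge0// => h.
  have -> : e = (e `^ a^-1) `^ a by rewrite -powRrM mulVf ?gt_eqF// powRr1// ltW.
  by apply: gt0_ltr_powR; rewrite ?nnegrE// ltW.
have lp : 0 < l by rewrite lt_def lnz.
rewrite {2}/powR gt_eqF//.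
have : expR (a * ln (u t)) @[t --> \oo] --> expR (a * ln l).
  apply: continuous_cvg; first exact: continuous_expR.
  by apply: cvgMr; apply: continuous_cvg => //; exact: continuous_ln.
apply: cvg_trans; apply: near_eq_cvg.
move/cvgrPdist_lt : ul => /(_ _ lp); apply: filterS => t ht.
rewrite /powR gt_eqF//; move: ht; rewrite ltr_norml; lra.
Qed.

Lemma fine_pos_power u : fine (pos_power m a u) = fine (N (pos u)) `^ a.
Proof.
have an0 : a != 0 by rewrite gt_eqF.
apply: etrans (fine_poweR _ _); congr fine; apply: etrans (esym (powR_Lnorm _ _ an0)).
by apply: eq_integral => x _ /=; rewrite ger0_norm// le_max lexx orbT.
Qed.

Lemma pos_power_cvg (u : (E -> R)^nat) v : v \in Lfun m a%:E ->
  (forall t, u t \in Lfun m a%:E) ->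
  N (fun x => u t x - v x)%R @[t --> \oo] --> 0%E ->
  fine (pos_power m a (u t)) @[t --> \oo] --> fine (pos_power m a v).
Proof.
move=> lv lu uv.
have -> : (fun t => fine (pos_power m a (u t))) = (fun t => fine (N (pos (u t))) `^ a).
  by apply/funext => t; exact: fine_pos_power.
rewrite [X in _ --> X]fine_pos_power.
apply: cvg_powR => [t|]; first by rewrite fine_ge0// Lnorm_ge0.
have finN (w : E -> R) : w \in Lfun m a%:E -> N w = (fine (N w))%:E.
  by move=> lw; rewrite fineK// ge0_fin_numE ?Lnorm_ge0// Lfun_lty.
have uv' : fine (N (fun x => u t x - v x)%R) @[t --> \oo] --> 0.
  by apply: fine_cvg; exact: uv.
apply/cvgrPdist_le => e e0.
move/cvgrPdist_le : uv' => /(_ e e0); apply: filterS => t.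
rewrite sub0r normrN ger0_norm ?fine_ge0 ?Lnorm_ge0//; apply: le_trans.
have lB := LfunB (lu t) lv.
have := Lnorm_pos_le (Lfun_measurable (lu t)) (Lfun_measurable lv).
have := Lnorm_pos_le (Lfun_measurable lv) (Lfun_measurable (lu t)).
rewrite (_ : N (fun x => v x - u t x) = N (fun x => u t x - v x)); last first.
  rewrite -oppe_Lnorm; by apply: eq_Lnorm => x /=; rewrite opprB.
rewrite (finN _ (Lfun_pos lv)) (finN _ (Lfun_pos (lu t))) (finN _ lB) /= !lee_fin.
by move=> h1 h2; rewrite ler_norml; lra.
Qed.

End Lnorm_limits.

Section limit_in_probability.
Context (R : realType) (dO : measure_display) (Omega : measurableType dO).
Variable P : probability Omega R.

Lemma sin_norm_le (x : R) : `|sin x| <= `|x|.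
Proof.
wlog x0 : x / 0 <= x.
  move=> h; have [x0|x0] := leP 0 x; first exact: h.
  by rewrite -normrN -sinN -(normrN x); apply: h; rewrite oppr_ge0 ltW.
have [|c _] := @MVT_segment R sin cos 0 x x0.
  by apply/continuous_subspaceT => y; exact: continuous_sin.
rewrite sin0 !subr0 => ->; rewrite normrM ler_piMl//.
by rewrite ler_norml cos_geN1 cos_le1.
Qed.

Lemma cos_sub_norm_le (x y : R) : `|cos x - cos y| <= `|x - y|.
Proof.
have gen (u v : R) : `|cos (u + v) - cos (u - v)| <= `|2 * v|.
  rewrite cosD cosB (_ : _ - _ = - (2 * (sin u * sin v))); last by ring.
  rewrite normrN !normrM ler_wpM2l//; apply: le_trans (sin_norm_le v).
  by rewrite ler_piMl// norm_sin_le1.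
have := gen ((x + y) / 2) ((x - y) / 2).
have -> : (x + y) / 2 + (x - y) / 2 = x by field.
have -> : (x + y) / 2 - (x - y) / 2 = y by field.
by have -> : 2 * ((x - y) / 2) = x - y by field.
Qed.

Lemma sin_sub_norm_le (x y : R) : `|sin x - sin y| <= `|x - y|.
Proof.
rewrite -!cosBpihalf (le_trans (cos_sub_norm_le _ _))//.
by rewrite opprB addrA subrK.
Qed.

Lemma cvg_sumr I (s : seq I) (u : I -> R^nat) (l : I -> R) :
  (forall i, u i t @[t --> \oo] --> l i) ->
  \sum_(i <- s) u i t @[t --> \oo] --> \sum_(i <- s) l i.
Proof.
move=> ul; elim: s => [|i s IH].
  rewrite big_nil; under eq_fun do rewrite big_nil.
  exact: cvg_cst.
rewrite big_cons; under eq_fun do rewrite big_cons.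
exact: cvgD.
Qed.

(** A function that is 1-Lipschitz and bounded by 1 moves by at most $e/2$ off the
    sets where some variable is $d$ away from its limit, and by at most 2 on
    them. *)
Lemma Ex_cvg_in_probability (n : nat) (th : 'I_n -> R)
    (u : nat -> 'I_n -> Omega -> R) (Y : 'I_n -> Omega -> R) (phi : R -> R) :
  (forall t k, measurable_fun setT (u t k)) ->
  (forall k, measurable_fun setT (Y k)) ->
  measurable_fun setT phi -> (forall x, `|phi x| <= 1) ->
  (forall x y, `|phi x - phi y| <= `|x - y|) ->
  (forall k, cvg_in_probability P (fun t => u t k) (Y k)) ->
  Ex P (fun w => phi (\sum_k th k * u t k w)) @[t --> \oo] -->
  Ex P (fun w => phi (\sum_k th k * Y k w)).
Proof.
move=> mu mY mphi phi1 philip uY.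
pose T := 1 + \sum_k `|th k|.
have T0 : 0 < T by rewrite ltr_pwDl// sumr_ge0.
apply/cvgrPdist_le => e e0; pose d := (e / 2) / T.
have d0 : 0 < d by rewrite !divr_gt0.
pose bad t k := [set w | d <= `|u t k w - Y k w|].
have mbad t k : measurable (bad t k).
  rewrite (_ : bad t k = (fun w => `|u t k w - Y k w|) @^-1` `[d, +oo[%classic).
    rewrite -[X in measurable X]setTI.
    have mf : measurable_fun setT (fun w => `|u t k w - Y k w|).
      by apply: measurableT_comp => //; exact: measurable_funB.
    exact: mf.
  by apply/seteqP; split => w /=; rewrite in_itv/= andbT.
have mlin (Z : 'I_n -> Omega -> R) : (forall k, measurable_fun setT (Z k)) ->
    bdd_measurable (fun w => phi (\sum_k th k * Z k w)).
  move=> mZ; split; last by exists 1.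
  apply: measurableT_comp => //; apply: measurable_sum => k.
  exact: measurable_funM.
have ptw t w : `|phi (\sum_k th k * Y k w) - phi (\sum_k th k * u t k w)| <=
    e / 2 + 2 * \sum_k \1_(bad t k) w.
  have [[k bk]|good] := pselect (exists k, bad t k w).
    rewrite (le_trans (ler_normB _ _))// (le_trans (lerD (phi1 _) (phi1 _)))//.
    rewrite (bigD1 k)//= indicE mem_set//.
    have : 0 <= \sum_(i < n | i != k) \1_(bad t i) w :> R by exact: sumr_ge0.
    by move: e0; rewrite mulr1n; set s := \sum_(_ < _ | _) _; lra.
  apply: (@le_trans _ _ (e / 2)); last first.
    by rewrite lerDl mulr_ge0// sumr_ge0.
  apply: le_trans (philip _ _) _; rewrite -sumrB.
  apply: le_trans (ler_norm_sum _ _ _) _.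
  apply: (@le_trans _ _ (\sum_k `|th k| * d)).
    apply: ler_sum => k _; rewrite -mulrBr normrM ler_wpM2l// distrC.
    by apply/ltW; rewrite ltNge; apply/negP => h; apply: good; exists k.
  rewrite -mulr_suml /d mulrA ler_pdivrMr// mulrC ler_pM2l ?divr_gt0//.
  by rewrite /T lerDr.
have bound t : `|Ex P (fun w => phi (\sum_k th k * Y k w)) -
                 Ex P (fun w => phi (\sum_k th k * u t k w))| <=
    e / 2 + 2 * \sum_k fine (P (bad t k)).
  have bY := mlin Y mY; have bu := mlin (u t) (mu t).
  have bi k : bdd_measurable (\1_(bad t k) : Omega -> R) by exact: bdd_indic.
  have bs : bdd_measurable (fun w => \sum_k (\1_(bad t k) w : R)).
    exact: (@bdd_sum _ _ _ _ _ _ (fun k => \1_(bad t k) : Omega -> R)).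
  rewrite -ExB//; apply: le_trans (norm_Ex_le P (bddB bY bu)) _.
  have <- : Ex P (fun w => e / 2 + 2 * \sum_k \1_(bad t k) w) =
      e / 2 + 2 * \sum_k fine (P (bad t k)).
    rewrite ExD; [|exact: bdd_cst|exact: bddZ].
    rewrite Rintegral_cst// ExZ//= probability_setT mulr1 Ex_sum//.
    by congr (_ + _ * _); apply: eq_bigr => k _; rewrite Ex_indic.
  apply: le_Ex => //.
    have [mB [K BK]] := bddB bY bu; split; first exact: measurableT_comp.
    by exists K => w; rewrite normr_id.
  by apply: bddD; [exact: bdd_cst|exact: bddZ].
have lim0 : \sum_k fine (P (bad t k)) @[t --> \oo] --> (\sum_(k < n) 0 : R).
  apply: cvg_sumr => k; apply: fine_cvg.
  exact: uY.
rewrite big1// in lim0.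
have e4 : 0 < e / 4 by exact: divr_gt0.
move/cvgrPdist_le : lim0 => /(_ _ e4); apply: filterS => t.
rewrite sub0r normrN => h; apply: le_trans (bound t) _.
have := le_trans (ler_norm _) h; set s := \sum_k _; lra.
Qed.

End limit_in_probability.

Section stable_integral_law.
Import HBSimple.
Context (R : realType) (dO : measure_display) (Omega : measurableType dO).
Variable P : probability Omega R.
Context (dE : measure_display) (E : measurableType dE).
Variables (m : {measure set E -> \bar R}) (alpha b : R).
Hypothesis alpha1 : 1 <= alpha.
Variable M : set E -> {RV P >-> R}.
Hypothesis hM : stable_random_measure m alpha b M.

Let cvg_stable_cf (It Jt : R^nat) (I J kap : R) :
  It t @[t --> \oo] --> I -> Jt t @[t --> \oo] --> J ->
  (expR (- (It t + Jt t)) * cos (kap * (It t - Jt t)) @[t --> \oo] -->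
     expR (- (I + J)) * cos (kap * (I - J))) /\
  (expR (- (It t + Jt t)) * sin (kap * (It t - Jt t)) @[t --> \oo] -->
     expR (- (I + J)) * sin (kap * (I - J))).
Proof.
move=> cI cJ.
have cE : expR (- (It t + Jt t)) @[t --> \oo] --> expR (- (I + J)).
  apply: continuous_cvg; first exact: continuous_expR.
  by apply: cvgN; exact: cvgD.
have cK : kap * (It t - Jt t) @[t --> \oo] --> kap * (I - J).
  by apply: cvgMr; exact: cvgB.
by split; apply: cvgM => //; apply: continuous_cvg => //;
  [exact: continuous_cos|exact: continuous_sin].
Qed.

(** For simple functions this is a finite sum of independent variables; on the
    probability side the expectations of the cosine and of the sine pass to
    limits in probability, on the other side the integrals of $(f^\pm)^\alpha$
    pass to limits in $L^\alpha$.  Any approximating sequence gives the same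
    answer, so that the law of the limit does not depend on its choice. *)
Theorem stable_integral_cf (n : nat) (f : 'I_n -> E -> R)
    (Y : 'I_n -> {RV P >-> R}) (th : 'I_n -> R) :
  (forall k, is_stable_integral m alpha M (f k) (Y k)) ->
  stable_cf P (fine (pos_power m alpha (fun x => \sum_k th k * f k x)))
    (fine (pos_power m alpha (fun x => - \sum_k th k * f k x)))
    (b * tan (pi * alpha / 2)) (fun w => \sum_k th k * Y k w).
Proof.
move=> fY; have alpha0 : 0 < alpha by exact: lt_le_trans alpha1.
have fL k : f k \in Lfun m alpha%:E by case: (fY k).
have [g gP] := choice (fun k => (fY k).2).
have gL k t : (g k t : E -> R) \in Lfun m alpha%:E by case: (gP k).
pose h x := \sum_k th k * f k x.
pose ht t x := \sum_k th k * g k t x.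
have linL (u : 'I_n -> E -> R) : (forall k, u k \in Lfun m alpha%:E) ->
    (fun x => \sum_k th k * u k x) \in Lfun m alpha%:E.
  move=> uL; apply: (@Lfun_sum _ _ _ _ _ alpha1 _ _ (fun k x => th k * u k x)).
  by move=> k; exact: LfunZ.
have hL : h \in Lfun m alpha%:E by exact: linL.
have htL t : ht t \in Lfun m alpha%:E by exact: (linL (fun k => g k t)).
have hth : ('N[m]_(alpha%:E)[EFin \o (fun x => ht t x - h x)%R])%E @[t --> \oo]
    --> 0%E.
  have := @Lnorm_sum_cvg0 _ _ _ m _ alpha1 _ (index_enum 'I_n) th
    (fun k t x => g k t x - f k x).
  move=> /(_ (fun k t => LfunB alpha1 (gL k t) (fL k))).
  have g0 k : ('N[m]_(alpha%:E)[EFin \o (fun x => g k t x - f k x)%R])%E @[t --> \oo]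
    --> 0%E by case: (gP k).
  move=> /(_ g0); apply: cvg_trans; apply: near_eq_cvg; apply: nearW => t.
  apply: eq_Lnorm => x /=; rewrite /ht /h -sumrB; congr EFin.
  by apply: eq_bigr => k _; rewrite mulrBr.
pose I := fine (pos_power m alpha h).
pose J := fine (pos_power m alpha (fun x => - h x)).
pose It t := fine (pos_power m alpha (ht t)).
pose Jt t := fine (pos_power m alpha (fun x => - ht t x)).
have cI : It t @[t --> \oo] --> I by exact: pos_power_cvg.
have cJ : Jt t @[t --> \oo] --> J.
  apply: (pos_power_cvg alpha1 (u := fun t x => - ht t x)) => //.
  - exact: LfunN.
  - by move=> t; exact: LfunN.
  - move: hth; apply: cvg_trans; apply: near_eq_cvg; apply: nearW => t.
    by rewrite -oppe_Lnorm; apply: eq_Lnorm => x /=; congr EFin; ring.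
pose kap := b * tan (pi * alpha / 2).
have [cC cS] := cvg_stable_cf kap cI cJ.
have scf t := simple_stable_cf alpha0 hM th (fun k => gL k t).
have mS t k : measurable_fun setT (simple_stable_integral M (g k t)).
  exact: measurable_simple_stable_integral.
have gY k : cvg_in_probability P (fun t => simple_stable_integral M (g k t)) (Y k).
  by case: (gP k).
have mY k : measurable_fun setT (Y k) by [].
have lim (phi : R -> R) := @Ex_cvg_in_probability _ _ _ P _ th
  (fun t k => simple_stable_integral M (g k t)) (fun k => Y k) phi mS mY.
have lcos := lim _ (@measurable_cos R) (@norm_cos_le1 R) (@cos_sub_norm_le R) gY.
have lsin := lim _ (@measurable_sin R) (@norm_sin_le1 R) (@sin_sub_norm_le R) gY.
split.
- rewrite -(cvg_lim _ lcos)//; apply: cvg_lim => //.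
  move: cC; apply: cvg_trans; apply: near_eq_cvg; apply: nearW => t.
  exact: esym (scf t).1.
- rewrite -(cvg_lim _ lsin)//; apply: cvg_lim => //.
  move: cS; apply: cvg_trans; apply: near_eq_cvg; apply: nearW => t.
  exact: esym (scf t).2.
Qed.

End stable_integral_law.

(** * Linear images of Lebesgue measure *)

Section rescaling.
Context (R : realType).

Definition rescales d (T : measurableType d) (m : {measure set T -> \bar R})
    (f : T -> T) (k : R) :=
  forall A, measurable A -> m (f @^-1` A) = (k%:E * m A)%E.

Lemma ge0_integral_rescales d (T : measurableType d)
    (m : {measure set T -> \bar R}) (f : T -> T) (k : R) (h : T -> \bar R)
    (D : set T) :
  0 <= k -> measurable_fun setT f -> rescales m f k -> measurable D ->
  measurable_fun D h -> (forall x, D x -> 0 <= h x)%E ->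
  (\int[m]_(x in f @^-1` D) h (f x) = k%:E * \int[m]_(x in D) h x)%E.
Proof.
move=> k0 mf fk mD mh h0.
rewrite -(ge0_integral_pushforward mf m mD mh); last first.
  by move=> x; rewrite inE; exact: h0.
pose kn : {nonneg R} := NngNum k0.
rewrite -(ge0_integral_mscale m mD kn mh h0).
by apply: eq_measure_integral => A mA _; exact: fk.
Qed.

Lemma rescales_product d1 d2 (T1 : measurableType d1) (T2 : measurableType d2)
    (m1 : {sigma_finite_measure set T1 -> \bar R})
    (m2 : {sigma_finite_measure set T2 -> \bar R})
    (f1 : T1 -> T1) (f2 : T2 -> T2) (k1 k2 : R) :
  0 < k1 -> 0 < k2 -> measurable_fun setT f1 -> measurable_fun setT f2 ->
  rescales m1 f1 k1 -> rescales m2 f2 k2 ->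
  rescales (m1 \x m2)%E (fun z => (f1 z.1, f2 z.2)) (k1 * k2).
Proof.
move=> k10 k20 mf1 mf2 f1k f2k A mA; set f := fun z => _.
have mf : measurable_fun setT f.
  apply/measurable_fun_pairP; split.
    by apply: (measurableT_comp mf1); exact: measurable_fst.
  by apply: (measurableT_comp mf2); exact: measurable_snd.
have k0 : 0 < k1 * k2 by exact: mulr_gt0.
have kV0 : 0 <= (k1 * k2)^-1 by rewrite invr_ge0 ltW.
pose kn : {nonneg R} := NngNum kV0.
pose nu := measure_function_pushforward__canonical__measure_function_Measure
  (m1 \x m2)%E mf.
have E : ((m1 \x m2) A = mscale kn nu A)%E.
  apply: product_measure_unique => // B C mB mC.
  change (((k1 * k2)^-1%:E * (m1 \x m2) ((f1 @^-1` B) `*` (f2 @^-1` C)) =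
    m1 B * m2 C)%E).
  rewrite product_measure1E//; last 2 first.
  - by rewrite -[X in measurable X]setTI; exact: mf1.
  - by rewrite -[X in measurable X]setTI; exact: mf2.
  have E : (k1%:E * m1 B * (k2%:E * m2 C) = (k1 * k2)%:E * (m1 B * m2 C))%E.
    by rewrite muleACA EFinM.
  by rewrite f1k// f2k// E muleA -EFinM mulVf ?gt_eqF// mul1e.
apply: etrans (congr1 (mule (k1 * k2)%:E) (esym E)).
by rewrite /mscale /= muleA -EFinM mulfV ?gt_eqF// mul1e.
Qed.

Lemma rescales_lebesgue_affine (c s : R) : 0 < c ->
  rescales (@lebesgue_measure R) (fun x => c * x + s) c^-1.
Proof.
move=> c0 A mA; set f := fun x => _.
have mf : measurable_fun (setT : set (measurableTypeR R)) (f : _ -> measurableTypeR R).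
  by apply: measurable_funD => //; exact: measurable_funM.
pose kn : {nonneg R} := NngNum (ltW c0).
pose nu := measure_function_pushforward__canonical__measure_function_Measure
  (@lebesgue_measure R) mf.
have E : lebesgue_measure A = mscale kn nu A.
  apply: lebesgue_measure_unique => // _ [[u v] _ <-].
  change (lebesgue_measure `]u, v]%classic =
    (c%:E * lebesgue_measure (f @^-1` `]u, v]%classic))%E).
  rewrite (_ : f @^-1` _ = `](u - s) / c, (v - s) / c]%classic); last first.
    apply/seteqP; split => x /=; rewrite !in_itv/= ltr_pdivrMr// ler_pdivlMr//;
      rewrite /f mulrC => /andP[? ?]; apply/andP; split; lra.
  rewrite !lebesgue_measure_itv/= !lte_fin ltr_pM2r ?invr_gt0// ltrD2r.
  case: ifPn => _; last by rewrite mule0.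
  by rewrite -!EFinB -EFinM; congr EFin; field; rewrite gt_eqF.
apply: etrans (congr1 (mule c^-1%:E) (esym E)).
by rewrite /mscale /= muleA -EFinM mulVf ?gt_eqF// mul1e.
Qed.

Lemma cV_cons_head d (z : measurableTypeR R * 'cV[R]_d) :
  cV_cons z ord0 ord0 = z.1.
Proof. exact: (congr1 fst (cV_consK z)). Qed.

Lemma cV_cons_tail d (z : measurableTypeR R * 'cV[R]_d) i :
  cV_cons z (lift ord0 i) ord0 = z.2 i ord0.
Proof. by have /colP/(_ i) := congr1 snd (cV_consK z); rewrite mxE. Qed.

(** One coordinate at a time, since Lebesgue measure is an iterated product. *)
Lemma rescales_lebesgue_cV_affine d (c : R) (s : 'cV[R]_d) : 0 < c ->
  rescales (lebesgue_cV R d) (fun x => c *: x + s) (c^-1 ^+ d).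
Proof.
move=> c0; elim: d s => [|d IH] s A mA.
  rewrite expr0 mul1e; congr (lebesgue_cV R 0 _); apply/seteqP.
  by split => x /=; rewrite (flatmx0 (c *: x + s)) (flatmx0 x).
pose s' : 'cV[R]_d := (cV_uncons s).2.
pose f (z : measurableTypeR R * 'cV[R]_d) :=
  (c * z.1 + s ord0 ord0, c *: z.2 + s') : measurableTypeR R * 'cV[R]_d.
have fE z : c *: cV_cons z + s = cV_cons (f z).
  apply/colP => i; case: (unliftP ord0 i) => [j|] ->.
    by rewrite 2!mxE !cV_cons_tail 3!mxE.
  by rewrite 2!mxE !cV_cons_head.
have mc : measurable (@cV_cons R d @^-1` A).
  by rewrite -[X in measurable X]setTI; exact: measurable_cV_cons.
have m1 : measurable_fun setT (fun x : measurableTypeR R =>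
    (c * x + s ord0 ord0 : measurableTypeR R)).
  by apply: measurable_funD => //; exact: measurable_funM.
have m2 : measurable_fun setT (fun x : 'cV[R]_d => c *: x + s').
  exact: (measurableT_comp (measurable_translation s') (measurable_dilation c)).
have cV0 : 0 < c^-1 by rewrite invr_gt0.
have := rescales_product cV0 (exprn_gt0 d cV0) m1 m2
  (rescales_lebesgue_affine (s ord0 ord0) c0) (IH s') mc.
rewrite -exprS => <-; congr ((lebesgue_measure \x lebesgue_cV R d)%E _).
by apply/seteqP; split => z /=; rewrite fE.
Qed.

End rescaling.

Section haar_uniqueness.
Context (R : realType) (d : nat).
Variables m1 m2 : {sigma_finite_measure set 'cV[R]_d -> \bar R}.
Hypothesis m1_inv : forall s, rescales m1 (fun x => x + s) 1.
Hypothesis m2_inv : forall s, rescales m2 (fun x => x + s) 1.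

Let m12E (S : set ('cV[R]_d * 'cV[R]_d)) : measurable S ->
  ((m1 \x m2) S = (m1 \x^ m2) S)%E.
Proof.
by apply: product_measure_unique => B C mB mC; rewrite /= product_measure2E.
Qed.

(** Both products compute the $m_1\otimes m_2$ measure of
    $\{(x,y) : x+y\in A,\ y\in B\}$; for fixed $x$ the substitution
    $y\mapsto y-x$ turns this set into $\{(x,y) : y\in A,\ y-x\in B\}$. *)
Lemma translation_invariant_product (A B : set 'cV[R]_d) :
  measurable A -> measurable B -> (forall x, B (- x) = B x) ->
  (m1 A * m2 B = m1 B * m2 A)%E.
Proof.
move=> mA mB symB.
pose S := [set z : 'cV[R]_d * 'cV[R]_d | A (z.1 + z.2) /\ B z.2].
pose S' := [set z : 'cV[R]_d * 'cV[R]_d | A z.2 /\ B (z.2 - z.1)].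
have msnd : measurable_fun setT (snd : 'cV[R]_d * 'cV[R]_d -> 'cV[R]_d).
  exact: measurable_snd.
have mcoor1 i : measurable_fun setT (fun z : 'cV[R]_d * 'cV[R]_d => z.1 i ord0).
  apply: (measurableT_comp (f := fun x : 'cV[R]_d => x i ord0)).
    exact: measurable_coor.
  exact: measurable_fst.
have mcoor2 i : measurable_fun setT (fun z : 'cV[R]_d * 'cV[R]_d => z.2 i ord0).
  apply: (measurableT_comp (f := fun x : 'cV[R]_d => x i ord0)) => //.
  exact: measurable_coor.
have madd : measurable_fun setT (fun z : 'cV[R]_d * 'cV[R]_d => z.1 + z.2).
  apply: measurable_fun_cV => i.
  rewrite (_ : (fun _ => _) = fun z : 'cV[R]_d * 'cV[R]_d => z.1 i ord0 + z.2 i ord0).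
    exact: measurable_funD.
  by apply/funext => z; rewrite mxE.
have msub : measurable_fun setT (fun z : 'cV[R]_d * 'cV[R]_d => z.2 - z.1).
  apply: measurable_fun_cV => i.
  rewrite (_ : (fun _ => _) = fun z : 'cV[R]_d * 'cV[R]_d => z.2 i ord0 - z.1 i ord0).
    exact: measurable_funB.
  by apply/funext => z; rewrite !mxE.
have mpre (f : 'cV[R]_d * 'cV[R]_d -> 'cV[R]_d) (C : set 'cV[R]_d) :
    measurable_fun setT f -> measurable C -> measurable (f @^-1` C).
  by move=> mf mC; rewrite -[X in measurable X]setTI; exact: mf.
have mS : measurable S.
  by apply: measurableI; [exact: (mpre _ A madd)|exact: (mpre _ B msnd)].
have mS' : measurable S'.
  by apply: measurableI; [exact: (mpre _ A msnd)|exact: (mpre _ B msub)].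
have SS' : ((m1 \x m2) S = (m1 \x m2) S')%E.
  apply: eq_integral => x _ /=.
  have mx : measurable (xsection S' x) by exact: measurable_xsection.
  have := m2_inv x mx; rewrite mul1e => <-; congr (m2 _).
  by apply/seteqP; split => y /=; rewrite !xsectionP/= /S /S'/= addrK addrC.
have indI (C : set 'cV[R]_d) (k : \bar R) : measurable C -> (0 <= k)%E ->
    (\int[m2]_y ((\1_C y)%:E * k) = k * m2 C)%E.
  move=> mC k0; rewrite ge0_integralZr//; last first.
  - by apply/measurable_EFinP; exact: measurable_indic.
  by rewrite integral_indic// setIT muleC.
have ES : ((m1 \x^ m2) S = m1 A * m2 B)%E.
  rewrite -indI//; apply: eq_integral => y _ /=; rewrite indicE.
  have [yB|yB] := pselect (B y).
    rewrite mem_set// mul1e -[RHS]mul1e -(m1_inv y mA); congr (m1 _).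
    by apply/seteqP; split => x /=; rewrite ysectionP /S /=; [case|split].
  rewrite memNset// mul0e -(measure0 m1); congr (m1 _).
  by apply/seteqP; split => x //=; rewrite ysectionP /S /= => -[].
have ES' : ((m1 \x^ m2) S' = m1 B * m2 A)%E.
  rewrite -indI//; apply: eq_integral => y _ /=; rewrite indicE.
  have [yA|yA] := pselect (A y).
    rewrite mem_set// mul1e -[RHS]mul1e -(m1_inv (- y) mB); congr (m1 _).
    by apply/seteqP; split => x /=; rewrite ysectionP /S' /= -(symB (y - x)) opprB;
      [case|split].
  rewrite memNset// mul0e -(measure0 m1); congr (m1 _).
  by apply/seteqP; split => x //=; rewrite ysectionP /S' /= => -[].
by rewrite -ES -ES' -!m12E.
Qed.

End haar_uniqueness.

(** * Rotation invariance of Lebesgue measure *)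

Section pushforward_sigma_finite.
Context (R : realType) (d1 d2 : measure_display).
Context (T1 : measurableType d1) (T2 : measurableType d2).
Variables (m : {sigma_finite_measure set T1 -> \bar R}).
Variables (f : T1 -> T2) (g : T2 -> T1).
Hypotheses (mf : measurable_fun setT f) (mg : measurable_fun setT g).
Hypothesis fK : cancel f g.

Definition iso_pushforward : set T2 -> \bar R := pushforward m f.

HB.instance Definition _ := Measure.copy iso_pushforward
  (measure_function_pushforward__canonical__measure_function_Measure m mf).

Let iso_sigma_finite : sigma_finite setT iso_pushforward.
Proof.
have /sigma_finiteP[F [TF _ Foo]] := sigma_finiteT m.
exists (fun k => g @^-1` F k).
  by rewrite -preimage_bigcup -TF preimage_setT.
move=> k; have [mF Fk] := Foo k; split.
  by rewrite -[X in measurable X]setTI; exact: mg.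
rewrite /iso_pushforward /pushforward -comp_preimage.
by rewrite (_ : g \o f = id)//; apply/funext => x /=; exact: fK.
Qed.

HB.instance Definition _ := Measure_isSigmaFinite.Build _ _ _
  iso_pushforward iso_sigma_finite.

Definition sigma_finite_iso_pushforward : {sigma_finite_measure set T2 -> \bar R} :=
  [the {sigma_finite_measure set T2 -> \bar R} of iso_pushforward].

End pushforward_sigma_finite.

Section rotation.
Context (R : realType) (d : nat).
Implicit Types x y : 'cV[R]_d.

Lemma enormE x : enorm x = Num.sqrt ((x^T *m x) ord0 ord0).
Proof.
by congr Num.sqrt; rewrite mxE; apply: eq_bigr => i _; rewrite mxE expr2.
Qed.

Lemma enorm_rotate (Theta : 'M[R]_d) x : orthogonal_group Theta ->
  enorm (Theta *m x) = enorm x.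
Proof.
by move=> oT; rewrite !enormE trmx_mul mulmxA -(mulmxA x^T) oT mulmx1.
Qed.

Lemma enormN x : enorm (- x) = enorm x.
Proof.
by congr Num.sqrt; apply: eq_bigr => i _; rewrite mxE sqrrN.
Qed.

Lemma enormZ (a : R) x : 0 <= a -> enorm (a *: x) = a * enorm x.
Proof.
move=> a0; rewrite /enorm -[X in _ = X * _](ger0_norm a0) -sqrtr_sqr -sqrtrM ?sqr_ge0//.
congr Num.sqrt; rewrite mulr_sumr; apply: eq_bigr => i _.
by rewrite mxE exprMn.
Qed.

Lemma measurable_unit_ball : measurable (eball (0 : 'cV[R]_d) 1).
Proof.
have mn : measurable_fun setT (fun x : 'cV[R]_d => \sum_(i < d) x i ord0 ^+ 2).
  apply: measurable_sum => i; apply: measurable_funX; exact: measurable_coor.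
rewrite (_ : eball 0 1 =
    (fun x : 'cV[R]_d => \sum_(i < d) x i ord0 ^+ 2) @^-1` `]-oo, 1[%classic).
  by rewrite -[X in measurable X]setTI; exact: mn.
have E x : (enorm (x - 0) < 1) = (\sum_(i < d) x i ord0 ^+ 2 < 1).
  by rewrite subr0 /enorm -[X in _ < X]sqrtr1 ltr_sqrt// sqrtr1.
by apply/seteqP; split => x /=; rewrite /eball/= E in_itv.
Qed.

Lemma unit_ball_fin : (lebesgue_cV R d (eball 0 1) < +oo)%E.
Proof.
pose A (i : 'I_d) : set R := `]-1, 1[%classic.
have mA i : measurable (A i) by exact: measurable_itv.
apply: (@le_lt_trans _ _ (lebesgue_cV R d [set x | forall i, A i (x i ord0)])).
  apply: le_measure; rewrite ?inE; [exact: measurable_unit_ball|exact: measurable_box|].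
  move=> x; rewrite /eball/= subr0 /enorm => hx i.
  rewrite /A /= in_itv/= -ltr_norml -sqrtr_sqr (le_lt_trans _ hx)// ler_wsqrtr//.
  by rewrite (bigD1 i)//= lerDl sumr_ge0// => j _; exact: sqr_ge0.
rewrite lebesgue_cV_box// (eq_bigr (fun=> (1 - (-1))%:E)); last first.
  by move=> i _; rewrite lebesgue_measure_itv/= lte_fin gtrN// EFinB.
by rewrite prodEFin ltry.
Qed.

Lemma unit_ball_gt0 : (0 < lebesgue_cV R d (eball 0 1))%E.
Proof.
pose c : R := d.+1%:R^-1.
have c0 : 0 < c by rewrite invr_gt0.
have c1 : c <= 1 by rewrite invf_le1// ler1n.
pose A (i : 'I_d) : set R := `]-c, c[%classic.
have mA i : measurable (A i) by exact: measurable_itv.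
apply: (@lt_le_trans _ _ (lebesgue_cV R d [set x | forall i, A i (x i ord0)])).
  rewrite lebesgue_cV_box// (eq_bigr (fun=> (c - (-c))%:E)); last first.
    by move=> i _; rewrite lebesgue_measure_itv/= lte_fin gtrN// EFinB.
  rewrite prodEFin lte_fin prodr_gt0// => i _; rewrite opprK addr_gt0//.
apply: le_measure; rewrite ?inE; [exact: measurable_box|exact: measurable_unit_ball|].
move=> x /= hx; rewrite /eball/= subr0 /enorm -[ltRHS]sqrtr1 ltr_sqrt//.
apply: (@le_lt_trans _ _ (\sum_(i < d) c)).
  apply: ler_sum => i _; have := hx i; rewrite /A /= in_itv/= -ltr_norml => h.
  rewrite -real_normK ?num_real// expr2 (le_trans (ler_pM _ _ (ltW h) (ltW h)))//.
  by rewrite ler_piMl// ltW.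
by rewrite sumr_const card_ord -[_ *+ _]mulr_natl /c ltr_pdivrMr// mul1r ltr_nat.
Qed.

Lemma lebesgue_cV_translation s : rescales (lebesgue_cV R d) (fun x => x + s) 1.
Proof.
move=> A mA; have := rescales_lebesgue_cV_affine s (@ltr01 R) mA.
rewrite invr1 expr1n => <-; congr (lebesgue_cV R d _).
by apply/seteqP; split => x /=; rewrite scale1r.
Qed.

(** The image of Lebesgue measure is again translation invariant, hence
    proportional to it; the factor is 1 because the unit ball is its own image
    and has positive finite measure. *)
Lemma lebesgue_cV_rotation (Theta : 'M[R]_d) : orthogonal_group Theta ->
  rescales (lebesgue_cV R d) (mulmx Theta) 1.
Proof.
move=> oT A mA.
have fK : cancel (mulmx Theta : 'cV[R]_d -> 'cV[R]_d) (mulmx Theta^T).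
  by move=> x; rewrite mulmxA oT mul1mx.
have gK : cancel (mulmx Theta^T : 'cV[R]_d -> 'cV[R]_d) (mulmx Theta).
  by move=> x; rewrite mulmxA (mulmx1C oT) mul1mx.
pose nu := sigma_finite_iso_pushforward (lebesgue_cV R d)
  (measurable_mulmx Theta) (measurable_mulmx Theta^T) fK.
have nu_inv s : rescales nu (fun x => x + s) 1.
  move=> B mB; rewrite mul1e.
  have mTB : measurable (mulmx Theta @^-1` B : set 'cV[R]_d).
    by rewrite -[X in measurable X]setTI; exact: measurable_mulmx.
  have := lebesgue_cV_translation (Theta^T *m s) mTB; rewrite mul1e.
  apply: etrans; congr (lebesgue_cV R d _).
  by apply/seteqP; split => x /=; rewrite mulmxDr gK.
have mB := measurable_unit_ball.
have symB x : eball (0 : 'cV[R]_d) 1 (- x) = eball 0 1 x.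
  by rewrite /eball/= !subr0 enormN.
have := translation_invariant_product lebesgue_cV_translation nu_inv mA mB symB.
have -> : nu (eball 0 1) = lebesgue_cV R d (eball 0 1).
  congr (lebesgue_cV R d _); apply/seteqP.
  by split => x /=; rewrite /eball/= !subr0 enorm_rotate.
have fin : lebesgue_cV R d (eball 0 1) \is a fin_num.
  by rewrite ge0_fin_numE// unit_ball_fin.
rewrite muleC mul1e => E.
have inj (c u v : \bar R) : c \is a fin_num -> (0 < c)%E -> (c * u = c * v)%E -> u = v.
  move=> cfin c0 e; apply/eqP; rewrite eq_le.
  by rewrite -(lee_pmul2l cfin c0 u v) -(lee_pmul2l cfin c0 v u) e lexx.
exact: esym (inj _ _ _ fin unit_ball_gt0 E).
Qed.

End rotation.

(** * Invariance of the stable field *)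

Section control_measure_rescaling.
Context (R : realType) (d : nat) (alpha beta : R) (sigma C : {posnum R}).
Local Notation m := (control_measure d alpha beta sigma C).

(** The density $r^{-1-\beta}$ contributes $c^{1+\beta}$ and the image of $dr$
    contributes $c^{-1}$. *)
Lemma rescales_control_measure (f : 'cV[R]_d -> 'cV[R]_d) (k c : R) :
  0 < k -> 0 < c -> measurable_fun setT f -> rescales (lebesgue_cV R d) f k ->
  rescales m (fun z => (f z.1, c * z.2 : measurableTypeR R)) (c `^ beta * k).
Proof.
move=> k0 c0 mf fk A mA; set T := fun z => _.
pose K := sigma%:num `^ alpha * C%:num.
pose w (z : 'cV[R]_d * measurableTypeR R) : \bar R := (K * z.2 `^ (- 1 - beta))%:E.
pose D := [set z : 'cV[R]_d * measurableTypeR R | 0 < z.2].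
have K0 : 0 <= K by rewrite mulr_ge0// powR_ge0.
have w0 z : (0 <= w z)%E by rewrite lee_fin mulr_ge0// powR_ge0.
have mD : measurable D.
  rewrite (_ : D = snd @^-1` `]0%R, +oo[%classic); last first.
    by apply/seteqP; split => z /=; rewrite in_itv/= andbT.
  by rewrite -[X in measurable X]setTI; exact: measurable_snd.
have mw : measurable_fun setT w.
  apply/measurable_EFinP; apply: measurable_funM => //.
  exact: (measurableT_comp (measurable_powR (-1 - beta))).
have mc : measurable_fun setT (fun r : measurableTypeR R => (c * r : measurableTypeR R)).
  exact: measurable_funM.
have rc : rescales (@lebesgue_measure R) (fun r => c * r) c^-1.
  move=> B mB; rewrite -(rescales_lebesgue_affine 0 c0 mB).
  by congr (lebesgue_measure _); apply/seteqP; split => r /=; rewrite addr0.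
have cV0 : 0 < c^-1 by rewrite invr_gt0.
have mT : measurable_fun setT T.
  apply/measurable_fun_pairP; split.
    by apply: (measurableT_comp mf); exact: measurable_fst.
  by apply: (measurableT_comp mc); exact: measurable_snd.
have rT := rescales_product k0 cV0 mf mc fk rc.
have mAD : measurable (A `&` D) by exact: measurableI.
have TD : T @^-1` (A `&` D) = (T @^-1` A) `&` D.
  by apply/seteqP; split => z /= [Az]; rewrite /D /= pmulr_rgt0.
have wT z : D z -> w z = ((c `^ (1 + beta))%:E * w (T z))%E.
  move=> /ltW z0; rewrite /w /= powRM ?(ltW c0)// -EFinM; congr EFin.
  rewrite mulrCA; congr (_ * _); rewrite mulrA -powRD; last first.
    by rewrite (gt_eqF c0) implybT.
  by rewrite -opprD subrr powRr0 mul1r.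
have mE B : m B = (\int[lebesgue_cV R d \x lebesgue_measure]_(z in B `&` D) w z)%E by [].
rewrite [RHS](congr1 (mule (c `^ beta * k)%:E) (mE A)); apply: (etrans (mE _)).
pose w' z := ((c `^ (1 + beta))%:E * w z)%E.
have w'0 z : (0 <= w' z)%E by rewrite mule_ge0// lee_fin powR_ge0.
have mw' : measurable_fun setT w' by exact: measurable_funeM.
have kc0 : 0 <= k / c by rewrite divr_ge0 ?ltW.
have I1 := ge0_integral_rescales kc0 mT rT mAD (measurable_funTS mw')
  (fun z _ => w'0 z).
have I2 : (\int[lebesgue_cV R d \x lebesgue_measure]_(z in A `&` D) w' z =
    (c `^ (1 + beta))%:E *
    \int[lebesgue_cV R d \x lebesgue_measure]_(z in A `&` D) w z)%E.
  apply: ge0_integralZl_EFin => //; first exact: measurable_funTS.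
  exact: powR_ge0.
rewrite -TD; apply: (@etrans _ _
    (\int[lebesgue_cV R d \x lebesgue_measure]_(z in T @^-1` (A `&` D)) w' (T z))%E).
  apply: eq_integral => z; rewrite inE => -[_ Dz]; apply: wT.
  by rewrite /D /= -(pmulr_rgt0 _ c0).
apply: (etrans I1); rewrite I2.
rewrite muleA -EFinM; congr (_%:E * _)%E.
rewrite addrC powRD; last by rewrite (gt_eqF c0) implybT.
by rewrite powRr1 ?ltW//; field; rewrite gt_eqF.
Qed.

End control_measure_rescaling.

Section pos_power.
Context (R : realType) (dE : measure_display) (E : measurableType dE).
Variables (m : {measure set E -> \bar R}) (a : R).

Let measurable_pos_power (h : E -> R) : measurable_fun setT h ->
  measurable_fun setT (fun x => (Num.max (h x) 0 `^ a)%:E).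
Proof.
move=> mh; apply/measurable_EFinP.
apply: (@measurableT_comp _ _ _ _ _ _ (fun x : R => x `^ a)) => //.
exact: measurable_maxr.
Qed.

Lemma pos_power_rescales (T : E -> E) (k : R) (h : E -> R) :
  0 <= k -> measurable_fun setT T -> rescales m T k -> measurable_fun setT h ->
  pos_power m a (fun x => h (T x)) = (k%:E * pos_power m a h)%E.
Proof.
move=> k0 mT Tk mh.
have := @ge0_integral_rescales _ _ _ m T k (fun x => (Num.max (h x) 0 `^ a)%:E)
  setT k0 mT Tk measurableT (measurable_pos_power mh).
by rewrite preimage_setT; apply => x _; rewrite lee_fin powR_ge0.
Qed.

Lemma pos_power_scale (c : R) (h : E -> R) : 0 <= c -> measurable_fun setT h ->
  pos_power m a (fun x => c * h x) = ((c `^ a)%:E * pos_power m a h)%E.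
Proof.
move=> c0 mh; rewrite /pos_power -ge0_integralZl_EFin ?powR_ge0//; last 2 first.
- by move=> x _; rewrite lee_fin powR_ge0.
- exact: measurable_pos_power.
apply: eq_integral => x _; rewrite -EFinM -powRM// ?le_max ?lexx ?orbT//.
by rewrite maxr_pMr// mulr0.
Qed.

End pos_power.

Section field_invariance.
Context (R : realType) (d : nat) (alpha beta b : R) (sigma C_beta : {posnum R}).
Hypotheses (alpha1 : 1 <= alpha).
Context (dO : measure_display) (Omega : measurableType dO).
Variable P : probability Omega R.
Variable M : set ('cV[R]_d * measurableTypeR R) -> {RV P >-> R}.
Local Notation m := (control_measure d alpha beta sigma C_beta).
Hypothesis hM : stable_random_measure m alpha b M.
Variable Z : signed_measure R d -> {RV P >-> R}.
Hypothesis hZ : forall mu, M_space alpha beta mu ->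
  is_stable_integral m alpha M (ball_charge mu) (Z mu).

(** Translations, rotations and dilations of charges share this form: a charge
    enters the field only through its values on balls, and each operation permutes
    the balls. *)
Variables (op : signed_measure R d -> signed_measure R d).
Variables (f : 'cV[R]_d -> 'cV[R]_d) (c k : R).
Hypotheses (c0 : 0 < c) (k0 : 0 < k) (mf : measurable_fun setT f).
Hypothesis fk : rescales (lebesgue_cV R d) f k.
Hypothesis opE : forall mu x r,
  ball_charge (op mu) (x, r) = ball_charge mu (f x, c * r).

Let alpha0 : 0 < alpha. Proof. exact: lt_le_trans alpha1. Qed.

Lemma measurable_ball_charge (mu : signed_measure R d) : M_space alpha beta mu ->
  measurable_fun setT (ball_charge mu).
Proof. by move=> /hZ[/Lfun_measurable]. Qed.

Lemma M_space_op (mu : signed_measure R d) :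
  M_space alpha beta mu -> M_space alpha beta (op mu).
Proof.
move=> Mmu; have mb := measurable_ball_charge Mmu.
case: Mmu => C [p [q [p0 pb bq hC]]].
pose L := Num.max (c `^ p) (c `^ q).
exists (k * (`|C| * L)), p, q; split => // r r0.
have cr0 : 0 < c * r by exact: mulr_gt0.
pose h (x : 'cV[R]_d) : \bar R := (`|ball_charge mu (x, c * r)| `^ alpha)%:E.
have mh : measurable_fun setT h.
  apply/measurable_EFinP.
  apply: (@measurableT_comp _ _ _ _ _ _ (fun x : R => x `^ alpha)) => //.
  apply: measurableT_comp => //.
  exact: (measurable_fun_pair1 (f := ball_charge mu) (c * r) mb).
have -> : (\int[lebesgue_cV R d]_x (`|ball_charge (op mu) (x, r)| `^ alpha)%:E =
    k%:E * \int[lebesgue_cV R d]_x h x)%E.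
  have := ge0_integral_rescales (ltW k0) mf fk measurableT mh.
  rewrite preimage_setT => <-; last by move=> x _; rewrite lee_fin powR_ge0.
  by apply: eq_integral => x _; rewrite opE.
rewrite -mulrA EFinM lee_pmul2l ?lte_fin//.
apply: le_trans (hC _ cr0) _; rewrite lee_fin.
have min0 : 0 <= Num.min ((c * r) `^ p) ((c * r) `^ q).
  by rewrite le_min !powR_ge0.
apply: le_trans (ler_wpM2r min0 (ler_norm C)) _.
rewrite -mulrA ler_wpM2l// !powRM ?(ltW c0) ?(ltW r0)//.
have L0 : 0 <= L by rewrite le_max powR_ge0.
have [_|_] := leP (r `^ p) (r `^ q); rewrite ge_min; apply/orP; [left|right].
  by rewrite ler_wpM2r ?powR_ge0// le_max lexx.
by rewrite ler_wpM2r ?powR_ge0// le_max lexx orbT.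
Qed.

Let rho := (c `^ beta * k) `^ alpha^-1.

(** The linear combinations of the two fields have the same characteristic
    functions: those of the first are integrals of functions composed with a map
    that multiplies the control measure by $\rho^\alpha$, those of the second
    are integrals of functions multiplied by $\rho$. *)
Lemma same_fdd_op : same_fdd P (M_space alpha beta)
  (fun mu => Z (op mu)) (fun mu w => rho * Z mu w).
Proof.
move=> n t Mt.
have kap0 : 0 <= c `^ beta * k by rewrite mulr_ge0 ?powR_ge0// ltW.
have rho0 : 0 <= rho by exact: powR_ge0.
have rhoE : rho `^ alpha = c `^ beta * k.
  by rewrite /rho -powRrM mulVf ?gt_eqF// powRr1.
pose T (z : 'cV[R]_d * measurableTypeR R) := (f z.1, c * z.2 : measurableTypeR R).
have rT : rescales m T (c `^ beta * k) by exact: rescales_control_measure.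
have mT : measurable_fun setT T.
  apply/measurable_fun_pairP; split.
    by apply: (measurableT_comp mf); exact: measurable_fst.
  by apply: measurable_funM => //; exact: measurable_snd.
pose h (th : 'I_n -> R) z := \sum_i th i * ball_charge (t i) z.
have mh th : measurable_fun setT (h th).
  apply: measurable_sum => i; apply: measurable_funM => //.
  exact: measurable_ball_charge.
have hN th z : - h th z = h (fun i => - th i) z.
  by rewrite /h -sumrN; apply: eq_bigr => i _; rewrite mulNr.
have cfX th := stable_integral_cf alpha1 hM th (fun i => hZ (M_space_op (Mt i))).
have cfY th := stable_integral_cf alpha1 hM (fun i => rho * th i) (fun i => hZ (Mt i)).
have powE th : pos_power m alpha (fun z => \sum_i th i * ball_charge (op (t i)) z) =
    pos_power m alpha (fun z => \sum_i rho * th i * ball_charge (t i) z).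
  rewrite (_ : (fun z => _) = fun z => h th (T z)); last first.
    by apply/funext => -[x r]; apply: eq_bigr => i _; rewrite opE.
  rewrite (_ : (fun z => \sum_i rho * th i * _) = fun z => rho * h th z); last first.
    by apply/funext => z; rewrite /h mulr_sumr; apply: eq_bigr => i _; rewrite mulrA.
  by rewrite (pos_power_rescales alpha kap0 mT rT (mh th)) pos_power_scale// rhoE.
have powNE th : pos_power m alpha (fun z => - \sum_i th i * ball_charge (op (t i)) z) =
    pos_power m alpha (fun z => - \sum_i rho * th i * ball_charge (t i) z).
  have := powE (fun i => - th i).
  rewrite (_ : (fun z => _) = fun z => - \sum_i th i * ball_charge (op (t i)) z).
    move=> ->; congr (pos_power m alpha _); apply/funext => z.
    by rewrite -sumrN; apply: eq_bigr => i _; rewrite mulrN mulNr.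
  by apply/funext => z; rewrite -sumrN; apply: eq_bigr => i _; rewrite mulNr.
have linY th w : \sum_i th i * (rho * Z (t i) w) = \sum_i rho * th i * Z (t i) w.
  by apply: eq_bigr => i _; rewrite mulrA (mulrC (th i)).
apply: equal_laws => [i|i|th|th].
- by [].
- exact: measurable_funM.
- have [-> _] := cfX th; have [E _] := cfY th.
  rewrite powE powNE -E; apply: eq_Rintegral => w _.
  by rewrite linY.
- have [_ ->] := cfX th; have [_ E] := cfY th.
  rewrite powE powNE -E; apply: eq_Rintegral => w _.
  by rewrite linY.
Qed.

End field_invariance.

Section ball_images.
Context (R : realType) (d : nat).
Implicit Types (mu : signed_measure R d) (x : 'cV[R]_d) (r : R).

Lemma ball_charge_translate s mu x r :
  ball_charge (translate s mu) (x, r) = ball_charge mu (1 *: x + - s, 1 * r).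
Proof.
congr (fine (mu _)); apply/seteqP.
by split => y /=; rewrite /eball /= scale1r mul1r opprD opprK addrA addrAC.
Qed.

Lemma ball_charge_rotate (Theta : 'M[R]_d) mu x r : orthogonal_group Theta ->
  ball_charge (rotate_charge Theta mu) (x, r) = ball_charge mu (Theta^T *m x, 1 * r).
Proof.
move=> oT; congr (fine (mu _)).
have E y : enorm (Theta *m y - x) = enorm (y - Theta^T *m x).
  rewrite -(enorm_rotate (y - Theta^T *m x) oT) mulmxBr mulmxA.
  by rewrite (mulmx1C oT) mul1mx.
by apply/seteqP; split => y /=; rewrite /eball /= E mul1r.
Qed.

Lemma ball_charge_dilate (a : R) mu x r : 0 < a ->
  ball_charge (dilate a mu) (x, r) = ball_charge mu (a^-1 *: x + 0, a^-1 * r).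
Proof.
move=> a0; congr (fine (mu _)).
have E y : a *: y - x = a *: (y - a^-1 *: x).
  by rewrite scalerBr scalerA mulfV ?gt_eqF// scale1r.
have E' y : (enorm (y - (a^-1 *: x + 0)) < a^-1 * r) = (enorm (a *: y - x) < r).
  by rewrite addr0 ltr_pdivlMl// E (enormZ _ (ltW a0)).
by apply/seteqP; split => y /=; rewrite /eball /= E'.
Qed.

End ball_images.

Theorem proposition2p5 (R : realType) (d : nat) (hd : (1 <= d)%N)
  (alpha beta b : R) (sigma C_beta : {posnum R})
  (halpha : 1 < alpha <= 2) (hbeta : 0 < beta) (hbetad : beta != d%:R)
  (hb : -1 <= b <= 1)
  (dO : measure_display) (Omega : measurableType dO) (P : probability Omega R)
  (M : set ('cV[R]_d * measurableTypeR R) -> {RV P >-> R})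
  (hM : stable_random_measure (control_measure d alpha beta sigma C_beta)
          alpha b M)
  (Z : signed_measure R d -> {RV P >-> R})
  (hZ : forall mu : signed_measure R d, M_space alpha beta mu ->
     is_stable_integral (control_measure d alpha beta sigma C_beta) alpha M
       (ball_charge mu) (Z mu)) :
  [/\ forall s : 'cV[R]_d,
        same_fdd P (M_space alpha beta)
          (fun mu => Z (translate s mu)) (fun mu => Z mu),
      forall Theta : 'M[R]_d, orthogonal_group Theta ->
        same_fdd P (M_space alpha beta)
          (fun mu => Z (rotate_charge Theta mu)) (fun mu => Z mu) &
      forall a : R, 0 < a ->
        same_fdd P (M_space alpha beta)
          (fun mu => Z (dilate a mu))
          (fun mu w => a `^ ((d%:R - beta) / alpha) * Z mu w)].
Proof.
have alpha1 : 1 <= alpha by case/andP : halpha => /ltW.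
have maff (c : R) (s : 'cV[R]_d) : measurable_fun setT (fun x : 'cV[R]_d => c *: x + s).
  exact: (measurableT_comp (measurable_translation s) (measurable_dilation c)).
have mul1Z : (fun mu w => 1 * Z mu w) = (fun mu => Z mu : Omega -> R).
  by apply/funext => mu; apply/funext => w; rewrite mul1r.
split.
- move=> s.
  have k0 : 0 < (1 : R)^-1 ^+ d by rewrite invr1 expr1n.
  have := same_fdd_op alpha1 hM hZ (op := fun mu => translate s mu) ltr01 k0
    (maff 1 (- s)) (rescales_lebesgue_cV_affine (- s) ltr01)
    (ball_charge_translate s).
  by rewrite powR1 mul1r invr1 expr1n powR1 mul1Z.
- move=> Theta oT.
  have oT' : orthogonal_group Theta^T.
    by rewrite /orthogonal_group /= trmxK; exact: mulmx1C.
  have := same_fdd_op alpha1 hM hZ (op := fun mu => rotate_charge Theta mu)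
    ltr01 ltr01 (measurable_mulmx Theta^T) (lebesgue_cV_rotation oT')
    (fun mu x r => ball_charge_rotate mu x r oT).
  by rewrite powR1 mul1r powR1 mul1Z.
- move=> a a0; have aV0 : 0 < a^-1 by rewrite invr_gt0.
  have k0 : 0 < a^-1^-1 ^+ d by rewrite invrK exprn_gt0.
  have := same_fdd_op alpha1 hM hZ (op := fun mu => dilate a mu) aV0 k0
    (maff a^-1 0) (rescales_lebesgue_cV_affine 0 aV0)
    (fun mu x r => ball_charge_dilate mu x r a0).
  rewrite (_ : (a^-1 `^ beta * a^-1^-1 ^+ d) `^ alpha^-1 =
    a `^ ((d%:R - beta) / alpha))//.
  rewrite powRrM invrK; congr (_ `^ _).
  rewrite powRB; last by rewrite (gt_eqF a0) implybT.
  rewrite powR_mulrn ?(ltW a0)// mulrC -(powR_inv1 (ltW a0)) -powRrM mulN1r.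
  by rewrite powRN.
Qed.
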